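(* Let $a\in\mathbb{R}$. For any space-cusp $\gamma$ in $M^3(a)$, there exists a generic swallowtail $f$ along $\gamma$ (that is, with $f(u,0)=\gamma(u)$).
   Context: $M^3(a)$ is the (oriented) complete simply connected Riemannian $3$-manifold of constant sectional curvature $a$, with metric $g=\langle\,,\rangle$ and Levi-Civita connection $\nabla$. Let $o=(0,0)\in\mathbb{R}^2$. Space-cusp: a (germ at $u=0$ of a) $C^\infty$-map $\gamma$ from an open interval containing $0$ into $M^3(a)$ is a space-cusp at $u=0$ if $\gamma'(u)$ vanishes if and only if $u=0$, and $\nabla_u\gamma'(0)$, $\nabla_u\nabla_u\gamma'(0)$ are linearly independent. Swallowtail: a germ $f$ at $o$ of a $C^\infty$-map into $M^3(a)$ is a swallowtail if there are a diffeomorphism germ $\varphi$ of $\mathbb{R}^2$ at the origin and a diffeomorphism germ $\Phi$ from $M^3(a)$ to $\mathbb{R}^3$ with $\Phi(f(o))=\mathbf 0$ such that $\Phi\circ f\circ\varphi$ is $(u,v)\mapsto(u,2v^3+uv,3v^4+uv^2)$. Its parametrization is admissible if the $u$-axis is the singular set of $f$; swallowtails are taken with admissible parametrizations, so $u\mapsto f(u,0)$ parametrizes the singular set image. Generic: $f$ has a smooth unit normal vector field $\nu$, chosen so that $\det_g(\nabla_vf_u(o),f_v(o),\nu(o))>0$; set $\sigma^S_g:=\mathrm{sgn}\,\langle\nabla_vf_v(o),\nu(o)\rangle$. The swallowtail is generic if $\sigma^S_g\ne0$. *)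

(* Defs.v *)
From HB Require Import structures.
From mathcomp Require Import all_boot all_order all_algebra.
From mathcomp Require Import all_classical all_reals all_analysis.

Set Implicit Arguments.
Unset Strict Implicit.
Unset Printing Implicit Defensive.

Import Order.TTheory GRing.Theory Num.Theory.
Import numFieldNormedType.Exports.

Local Open Scope classical_set_scope.
Local Open Scope ring_scope.

(* A germ at a point is represented by a total function, of which only the
   values near that point are ever constrained. *)

Section Smooth.
Context {R : realType} {V W : normedModType R}.

(* On finite-dimensional spaces this is the usual class C^k on the open set U. *)
Fixpoint Ck (k : nat) (U : set V) (f : V -> W) : Prop :=
  match k with
  | 0 => forall x, U x -> {for x, continuous f}
  | k'.+1 => (forall x, U x -> differentiable f x) /\
             (forall v : V, Ck k' U ('D_v f))
  end.

Definition smooth_at (p : V) (f : V -> W) : Prop :=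
  exists U : set V, [/\ open U, U p & forall k, Ck k U f].

End Smooth.

(* Germ at p of a diffeomorphism from the submanifold A to the submanifold B,
   mapping p to q.  Smoothness on a submanifold means having a smooth extension
   to a neighborhood in the ambient space; phi itself is such an extension. *)
Definition diffeo_germ {R : realType} {V W : normedModType R}
    (A : set V) (B : set W) (p : V) (q : W) (phi : V -> W) : Prop :=
  [/\ phi p = q, smooth_at p phi &
   exists psi : W -> V,
     [/\ smooth_at q psi,
         \forall x \near p, A x -> B (phi x) /\ psi (phi x) = x &
         \forall y \near q, B y -> A (psi y) /\ phi (psi y) = y]].

Section SpaceForm.
Context {R : realType} (a : R).
Implicit Types x w : 'rV[R]_4.

Definition dot_sp w1 w2 : R :=
  \sum_(i < 3) w1 0 (lift ord0 i) * w2 0 (lift ord0 i).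

Definition cform w1 w2 : R := w1 0 0 * w2 0 0 + a * dot_sp w1 w2.

(* M^3(a) is modelled, uniformly in a, by the quadric
     x0^2 + a (x1^2 + x2^2 + x3^2) = 1   (with x0 > 0 if a <= 0)
   in R^4, with the metric induced by dx0^2 / a + dx1^2 + dx2^2 + dx3^2.  After
   rescaling x0 by |a|^(-1/2) this is the round sphere of radius a^(-1/2) in
   Euclidean space if a > 0, and the upper sheet of the hyperboloid
   <x, x> = 1 / a in Minkowski space if a < 0.  If a = 0 it is the hyperplane
   x0 = 1 with its Euclidean metric. *)
Definition space_form : set 'rV[R]_4 :=
  [set x | cform x x = 1 /\ (a <= 0 -> 0 < x 0 0)].

Definition tangent x : set 'rV[R]_4 := [set w | cform x w = 0].

(* If a = 0 then a^-1 = 0 and the first term disappears, as it should. *)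
Definition metric w1 w2 : R := a^-1 * (w1 0 0 * w2 0 0) + dot_sp w1 w2.

(* The orthogonal projection of R^4 onto the tangent space at x, for the
   ambient metric (if a = 0, the projection along x; it is then only applied
   to vectors which are already tangent). *)
Definition tproj x w : 'rV[R]_4 := w - cform x w *: x.

(* Covariant derivative, in the direction v at the point p, of a vector field X
   along a map f into the space form: the Levi-Civita connection of a
   (semi-)Riemannian submanifold is the tangential part of the ambient
   derivative. *)
Definition cov {V : normedModType R} (f : V -> 'rV[R]_4) (v : V)
    (X : V -> 'rV[R]_4) (p : V) : 'rV[R]_4 := tproj (f p) ('D_v X p).

(* The Riemannian volume form of the space form at x.  The unit normal is
   sqrt |a| x and the ambient volume form is |a|^(-1/2) dx0 dx1 dx2 dx3, so the
   two factors cancel; if a = 0 the first coordinates of x, w1, w2, w3 are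
   1, 0, 0, 0 and this is the determinant of R^3. *)
Definition det_g x w1 w2 w3 : R :=
  \det (\matrix_(i < 4) [:: x; w1; w2; w3]`_i).

Definition space_cusp (gamma : R -> 'rV[R]_4) : Prop :=
  let gamma' := 'D_1 gamma in
  let cov_u := cov gamma 1 in
  [/\ smooth_at 0 gamma,
      \forall u \near (0 : R), space_form (gamma u),
      \forall u \near (0 : R), gamma' u = 0 <-> u = 0 &
      free [:: cov_u gamma' 0; cov_u (cov_u gamma') 0]].

Definition e_u : R * R := (1, 0).
Definition e_v : R * R := (0, 1).

Definition std_swallowtail (p : R * R) : 'rV[R]_3 :=
  let: (u, v) := p in
  \row_(i < 3)
    [:: u; 2 * v ^+ 3 + u * v; 3 * v ^+ 4 + u * v ^+ 2]`_i.

Definition swallowtail (f : R * R -> 'rV[R]_4) : Prop :=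
  [/\ smooth_at 0 f,
      \forall p \near (0 : R * R), space_form (f p) &
      exists (phi : R * R -> R * R) (Phi : 'rV[R]_4 -> 'rV[R]_3),
        [/\ diffeo_germ setT setT 0 0 phi,
            diffeo_germ space_form setT (f 0) 0 Phi &
            \forall p \near (0 : R * R),
              Phi (f (phi p)) = std_swallowtail p]].

Definition singular_point (f : R * R -> 'rV[R]_4) (p : R * R) : Prop :=
  ~~ free [:: 'D_e_u f p; 'D_e_v f p].

Definition admissible (f : R * R -> 'rV[R]_4) : Prop :=
  \forall p \near (0 : R * R), singular_point f p <-> p.2 = 0.

Definition unit_normal_field (f nu : R * R -> 'rV[R]_4) : Prop :=
  smooth_at 0 nu /\
  \forall p \near (0 : R * R),
    [/\ tangent (f p) (nu p),
        metric (nu p) (nu p) = 1,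
        metric ('D_e_u f p) (nu p) = 0 &
        metric ('D_e_v f p) (nu p) = 0].

(* The choice of the sign of the unit normal field nu of a swallowtail. *)
Definition positive_normal (f nu : R * R -> 'rV[R]_4) : Prop :=
  0 < det_g (f 0) (cov f e_v ('D_e_u f) 0) ('D_e_v f 0) (nu 0).

Definition sigmaS (f nu : R * R -> 'rV[R]_4) : R :=
  Num.sg (metric (cov f e_v ('D_e_v f) 0) (nu 0)).

(* The germ nu is uniquely determined by f and the first two conditions. *)
Definition generic (f : R * R -> 'rV[R]_4) : Prop :=
  exists nu : R * R -> 'rV[R]_4,
    [/\ unit_normal_field f nu, positive_normal f nu & sigmaS f nu != 0].

Definition generic_swallowtail (f : R * R -> 'rV[R]_4) : Prop :=
  [/\ swallowtail f, admissible f & generic f].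

End SpaceForm.

(* Main.v *)
Require Import Defs.
From mathcomp Require Import all_boot all_order all_algebra.
From mathcomp Require Import all_classical all_reals all_analysis.
From mathcomp Require Import ring lra.
Set Implicit Arguments.
Unset Strict Implicit.
Unset Printing Implicit Defensive.
Import Order.TTheory GRing.Theory Num.Theory.
Import numFieldNormedType.Exports.
Local Open Scope classical_set_scope.
Local Open Scope ring_scope.

(**
Let b1, b2 be the second and third derivative of gamma at the cusp modulo
p = gamma(0), and complete p, b1, b2 to a basis of R^4.  In the central
projection from the origin onto the affine hyperplane of the points whose
p-coordinate is 1, the cusp has coordinates (u^2 m1, u^3 m2, u^2 m3) with m1(0),
m2(0) nonzero.  In the new parameter t = u sqrt(m1) it reads (t^2, t^3 n2, t^2 n3),
and by Whitney's theorem on even functions n_i = C_i(t^2) + t D_i(t^2).  Hence it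
is the image of t |-> (-6 t^2, -4 t^3, -3 t^4), the singular curve of the standard
swallowtail at (u, v) = (-6 t^2, t), under the map which, in terms of s = -x/6,
w = -y/4 and r = (z + x^2/12)/12, is
  Psi = (s, w C2(s) + s^2 D2(s), s C3(s) + w D3(s) + kap r).
It is triangular, so its inverse is explicit and no inverse function theorem is
needed beyond dimension one.  The swallowtail is f(u,v) = Psi(std(12 v - 6 t^2, t))
projected back to the space form.  Up to that projection f = P with
P_u = c P_v + v X, where c(0) = 0 and P, X, P_v are independent; so the singular set
is v = 0, the hyperplanes spanned by P, X, P_v provide a smooth unit normal, and f is
generic if and only if det(P, X, P_v, P_vv)(0) is nonzero, which holds for a suitable
constant kap.

Whitney's theorem: for even e, e(t) = A(t^2) with A(s) = e(sqrt s) for s > 0.  The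
derivatives of A are those of e under e |-> e'/(2 t), which preserves smooth even
functions by Hadamard's lemma.  To the left of 0, A is any smooth function with the
same derivatives at 0, given by Borel's lemma.
*)

(** * Calculus of smooth maps *)

Section Local.
Context {R : realType} {V W : normedModType R}.
Implicit Types (f g : V -> W) (U : set V).

(** The first-order expansion of [f] at [x], with linear part ['d f x], is also one of [g];
    uniqueness of the differential then identifies ['d g x]. *)
Lemma near_eq_differentiable f g x :
  (\forall y \near x, f y = g y) -> differentiable f x -> differentiable g x.
Proof.
move=> fg df; have fgx : f x = g x by exact: nbhs_singleton fg.
have dfc : continuous ('d f x) by exact: diff_continuous.
have E : g \o shift x = cst (g x) + 'd f x +o_ (0 : V) id.
  apply/eqaddoP => e e0.
  have /eqaddoP/(_ e e0) := diff_locally df.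
  have : \forall h \near (0 : V), f (h + x) = g (h + x).
    by move: fg; rewrite (near_shift 0)/=; apply: filterS => h /=; rewrite subr0.
  move=> H1 H2; near=> h.
  have H3 : f (h + x) = g (h + x) by near: h.
  have : `|(f \o shift x - (cst (f x) + 'd f x)) h| <= e * `|h| by near: h.
  by rewrite !fctE /= -fgx H3.
apply/diff_locallyP; rewrite (diff_unique dfc E); split => //.
Unshelve. all: by end_near. Qed.

Lemma Ck_sub k U U' f : U' `<=` U -> Ck k U f -> Ck k U' f.
Proof.
elim: k f => [|k IH] f UU' /=; first by move=> H x /UU'; exact: H.
by move=> [d c]; split=> [x /UU'|v]; [exact: d | exact: IH].
Qed.

Lemma Ck_pred k U f : Ck k.+1 U f -> Ck k U f.
Proof.
elim: k f => [|k IH] f /= [d c].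
  by move=> x Ux; apply: differentiable_continuous; exact: d.
by split => // v; apply: IH; exact: c.
Qed.

(** On an open set, equal values mean equal germs, so equality passes to all directional
    derivatives. The closure rules below use this to replace a derivative by a formula that is valid
    on [U] only. *)
Lemma Ck_ext k U f g : open U -> (forall x, U x -> f x = g x) ->
  Ck k U f -> Ck k U g.
Proof.
move=> oU; elim: k f g => [|k IH] f g fg /=.
  move=> fc x Ux; have nfg : \forall y \near x, f y = g y.
    by apply: filterS (open_nbhs_nbhs (conj oU Ux)) => y /fg.
  rewrite /prop_for /continuous_at -fg//.
  by apply: cvg_trans (fc x Ux); apply: near_eq_cvg.
have nfg x : U x -> \forall y \near x, f y = g y.
  by move=> Ux; apply: filterS (open_nbhs_nbhs (conj oU Ux)) => y /fg.
move=> [d c]; split=> [x Ux|v].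
  exact: near_eq_differentiable (nfg x Ux) (d x Ux).
apply: IH (c v) => x Ux; exact: near_eq_derive (nfg x Ux).
Qed.

End Local.

(** * Closure properties of the classes C^k *)

Section CkClosure.
Context {R : realType} {V : normedModType R} (U : set V) (oU : open U).

Lemma Ck_cst {W : normedModType R} k (a : W) : Ck k U (fun=> a).
Proof.
elim: k a => [|k IH] a /=; first by move=> x _; exact: cst_continuous.
split=> [x _|v]; first exact: differentiable_cst.
by rewrite (_ : 'D_v _ = fun=> 0) // funeqE => x; exact: derive_cst.
Qed.

Lemma CkD {W : normedModType R} k (f g : V -> W) :
  Ck k U f -> Ck k U g -> Ck k U (fun x => f x + g x).
Proof.
elim: k f g => [|k IH] f g /=.
  by move=> fc gc x Ux; apply: continuousD; [exact: fc | exact: gc].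
move=> [fd fc] [gd gc]; split=> [x Ux|v].
  by apply: differentiableD; [exact: fd | exact: gd].
apply: (Ck_ext oU _ (IH _ _ (fc v) (gc v))) => x Ux.
by rewrite -deriveD//; apply: diff_derivable; [exact: fd | exact: gd].
Qed.

Lemma Ck_lin {W W' : normedModType R} k (L : {linear W -> W'}) (f : V -> W) :
  continuous L -> Ck k U f -> Ck k U (fun x => L (f x)).
Proof.
move=> Lc; elim: k f => [|k IH] f /=.
  by move=> fc x Ux; apply: continuous_comp; [exact: fc | exact: Lc].
move=> [fd fc]; have Ld y : differentiable L y by exact: linear_differentiable.
split=> [x Ux|v]; first by apply: differentiable_comp => //; exact: fd.
apply: (Ck_ext oU _ (IH _ (fc v))) => x Ux.
rewrite [RHS](deriveE v (differentiable_comp (fd _ Ux) (Ld _))).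
by rewrite (diff_comp (fd _ Ux) (Ld _)) (diff_lin _ Lc) /= -deriveE//; exact: fd.
Qed.

Lemma Ck_id k : Ck k U id.
Proof.
case: k => [|k] /=; first by move=> x _; exact: cvg_id.
split=> [x _|v]; first by apply: ex_diff; exact: is_diff_id.
by rewrite (_ : 'D_v _ = fun=> v);
  [exact: Ck_cst | rewrite funeqE => x; exact: derive_id].
Qed.

Lemma CkM k (f g : V -> R) :
  Ck k U f -> Ck k U g -> Ck k U (fun x => f x * g x).
Proof.
elim: k f g => [|k IH] f g.
  by move=> fc gc x Ux; exact: (cvgM (fc x Ux) (gc x Ux)).
move=> cf cg; have [fd fc] := cf; have [gd gc] := cg.
split=> [x Ux|v]; first by apply: differentiableM; [exact: fd | exact: gd].
apply: (Ck_ext oU _ (CkD (IH _ _ (Ck_pred cf) (gc v)) (IH _ _ (Ck_pred cg) (fc v)))).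
move=> x Ux /=.
by rewrite [RHS]deriveM//; apply: diff_derivable; [exact: fd | exact: gd].
Qed.

Lemma CkZl {W : normedModType R} k (f : V -> R) (w : W) :
  Ck k U f -> Ck k U (fun x => f x *: w).
Proof.
elim: k f => [|k IH] f.
  by move=> fc x Ux; exact: (cvgZr_tmp (fc x Ux)).
move=> [fd fc]; split=> [x Ux|v]; first by apply: differentiableZl; exact: fd.
apply: (Ck_ext oU _ (IH _ (fc v))) => x Ux.
rewrite [RHS](deriveE v (differentiableZl w (fd _ Ux))).
by rewrite (diffZl w (fd _ Ux)) deriveE//; exact: fd.
Qed.

(** With an outer function of one real variable the chain rule is a product of real functions, so
    the induction on [k] reduces to [CkM]. *)
Lemma Ck_comp k (UR : set R) (g : R -> R) (f : V -> R) :
  (forall x, U x -> UR (f x)) -> Ck k UR g -> Ck k U f ->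
  Ck k U (fun x => g (f x)).
Proof.
move=> fU; elim: k g f fU => [|k IH] g f fU.
  move=> gc fc x Ux; apply: continuous_comp; first exact: fc.
  by apply: gc; exact: fU.
move=> [gd gc] cf; have [fd fc] := cf.
split=> [x Ux|v].
  by apply: differentiable_comp; [exact: fd | exact/gd/fU].
apply: (Ck_ext oU _ (CkM (fc v) (IH _ _ fU (gc 1) (Ck_pred cf)))) => x Ux /=.
have gdx := gd _ (fU _ Ux).
rewrite [RHS](deriveE v (differentiable_comp (fd _ Ux) gdx)).
rewrite (diff_comp (fd _ Ux) gdx) /= -(deriveE v (fd _ Ux)).
by rewrite -[X in _ = 'd g _ X]mulr1 [RHS]linearZ /= -deriveE.
Qed.

(** The derivative of 1/f is -(1/f)^2 times that of f: it contains 1/f only undifferentiated, so the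
    induction closes. *)
Lemma CkV k (f : V -> R) : (forall x, U x -> f x != 0) -> Ck k U f ->
  Ck k U (fun x => (f x)^-1).
Proof.
move=> f0; elim: k f f0 => [|k IH] f f0.
  by move=> fc x Ux; apply: continuousV; [exact: f0 | exact: fc].
move=> cf; have [fd fc] := cf.
split=> [x Ux|v]; first by apply: differentiableV; [exact: fd | exact: f0].
have cV := IH _ f0 (Ck_pred cf).
have cN : Ck k U (fun=> -1 : R) by exact: Ck_cst.
apply: (Ck_ext oU _ (CkM cN (CkM (CkM cV cV) (fc v)))) => x Ux /=.
rewrite [RHS](deriveV (f0 _ Ux)); last exact/diff_derivable/fd.
by rewrite mulN1r scaleNr -expr2 exprVn.
Qed.

End CkClosure.

(** * Smooth germs *)

Section Smooth.
Context {R : realType} {V : normedModType R}.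
Implicit Types (p : V).

Lemma smooth_at_ext {W : normedModType R} p (f g : V -> W) :
  (\forall x \near p, f x = g x) -> smooth_at p f -> smooth_at p g.
Proof.
move=> fgp; have : nbhs p [set x | f x = g x] by exact: fgp.
rewrite nbhsE => -[U' [oU' U'p] fg] [U [oU Up cf]].
have oI := openI oU oU'.
exists (U `&` U'); split=> // k; apply: (Ck_ext oI (f := f)).
  by move=> x [_ /fg].
by apply: Ck_sub (cf k); exact: subIsetl.
Qed.

Lemma smooth_at_cst {W : normedModType R} p (a : W) : smooth_at p (fun=> a).
Proof. by exists setT; split=> // [|k]; [exact: openT | exact: Ck_cst]. Qed.

Lemma smooth_at_id p : smooth_at p id.
Proof. by exists setT; split=> // [|k]; [exact: openT | exact: Ck_id]. Qed.

Lemma smooth_atD {W : normedModType R} p (f g : V -> W) :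
  smooth_at p f -> smooth_at p g -> smooth_at p (fun x => f x + g x).
Proof.
move=> [U [oU Up cf]] [U' [oU' U'p cg]].
have oI := openI oU oU'.
exists (U `&` U'); split=> // k; apply: (CkD oI).
  by apply: Ck_sub (cf k); exact: subIsetl.
by apply: Ck_sub (cg k); exact: subIsetr.
Qed.

Lemma smooth_at_lin {W W' : normedModType R} p (L : {linear W -> W'})
  (f : V -> W) : continuous L -> smooth_at p f -> smooth_at p (fun x => L (f x)).
Proof.
by move=> Lc [U [oU Up cf]]; exists U; split=> // k; exact: (Ck_lin oU).
Qed.

Lemma smooth_atM p (f g : V -> R) :
  smooth_at p f -> smooth_at p g -> smooth_at p (fun x => f x * g x).
Proof.
move=> [U [oU Up cf]] [U' [oU' U'p cg]].
have oI := openI oU oU'.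
exists (U `&` U'); split=> // k; apply: (CkM oI).
  by apply: Ck_sub (cf k); exact: subIsetl.
by apply: Ck_sub (cg k); exact: subIsetr.
Qed.

Lemma smooth_atZl {W : normedModType R} p (f : V -> R) (w : W) :
  smooth_at p f -> smooth_at p (fun x => f x *: w).
Proof. by move=> [U [oU Up cf]]; exists U; split=> // k; exact: (CkZl oU). Qed.

Lemma smooth_at_continuous {W : normedModType R} p (f : V -> W) :
  smooth_at p f -> {for p, continuous f}.
Proof. by move=> [U [oU Up /(_ 0)]]; exact. Qed.

Lemma smooth_at_comp p (g : R -> R) (f : V -> R) :
  smooth_at (f p) g -> smooth_at p f -> smooth_at p (fun x => g (f x)).
Proof.
move=> [UR [oUR URp cg]] sf; have fc := smooth_at_continuous sf.
have [U [oU Up cf]] := sf.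
have := fc _ (open_nbhs_nbhs (conj oUR URp)).
rewrite /= nbhs_filterE nbhsE => -[U' [oU' U'p] fU'].
have oI := openI oU oU'.
exists (U `&` U'); split=> // k; apply: (Ck_comp oI _ (cg k)).
  by move=> x [_ /fU'].
by apply: Ck_sub (cf k); exact: subIsetl.
Qed.

Lemma smooth_atV p (f : V -> R) : f p != 0 ->
  smooth_at p f -> smooth_at p (fun x => (f x)^-1).
Proof.
move=> f0 sf; have fc := smooth_at_continuous sf.
have [U [oU Up cf]] := sf.
have : nbhs p [set x | f x != 0] by exact: (cvgr_neq0 (f p) fc f0).
rewrite nbhsE => -[U' [oU' U'p] fU'].
have oI := openI oU oU'.
exists (U `&` U'); split=> // k; apply: (CkV oI); first by move=> x [_ /fU'].
by apply: Ck_sub (cf k); exact: subIsetl.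
Qed.

Lemma smooth_at_derive {W : normedModType R} p v (f : V -> W) :
  smooth_at p f -> smooth_at p ('D_v f).
Proof.
by move=> [U [oU Up cf]]; exists U; split=> // k; have [_ +] := cf k.+1; exact.
Qed.

Lemma smooth_at_near {W : normedModType R} p (f : V -> W) :
  smooth_at p f -> \forall q \near p, smooth_at q f.
Proof.
move=> [U [oU Up cf]]; apply: filterS (open_nbhs_nbhs (conj oU Up)) => q Uq.
by exists U; split.
Qed.

Lemma smooth_at_diff {W : normedModType R} p (f : V -> W) :
  smooth_at p f -> differentiable f p.
Proof. by move=> [U [oU Up /(_ 1) []]] + _; exact. Qed.

Lemma smooth_at_derivable {W : normedModType R} p v (f : V -> W) :
  smooth_at p f -> is_derive p v f ('D_v f p).
Proof. by move=> /smooth_at_diff df; apply/derivableP/diff_derivable. Qed.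

Lemma smooth_atN p (f : V -> R) :
  smooth_at p f -> smooth_at p (fun x => - f x).
Proof.
move=> sf; have sN : smooth_at p (fun=> -1 : R) by exact: smooth_at_cst.
apply: smooth_at_ext _ (smooth_atM sN sf).
by near=> x; rewrite mulN1r.
Unshelve. all: by end_near. Qed.

Lemma smooth_atB p (f g : V -> R) :
  smooth_at p f -> smooth_at p g -> smooth_at p (fun x => f x - g x).
Proof. by move=> sf sg; apply: smooth_atD sf (smooth_atN sg). Qed.

Lemma smooth_atX p n (f : V -> R) :
  smooth_at p f -> smooth_at p (fun x => f x ^+ n).
Proof.
move=> sf; elim: n => [|n IH]; first exact: smooth_at_cst.
apply: smooth_at_ext _ (smooth_atM sf IH).
by near=> x; rewrite exprS.
Unshelve. all: by end_near. Qed.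

Lemma smooth_at_sum {W : normedModType R} p (I : Type) (r : seq I)
    (P : pred I) (F : I -> V -> W) :
  (forall i, smooth_at p (F i)) ->
  smooth_at p (fun x => \sum_(i <- r | P i) F i x).
Proof.
move=> sF; elim: r => [|i r IH].
  by under eq_fun do rewrite big_nil; exact: smooth_at_cst.
under eq_fun do rewrite big_cons; case: (P i) => //.
exact: smooth_atD.
Qed.

End Smooth.

(** * Functions of one variable *)

Section DeriveRules.
Context {R : realType} {V : normedModType R}.
Implicit Types (f g : V -> R) (x v : V).

Lemma is_deriveE {W : normedModType R} x v (f : V -> W) df :
  is_derive x v f df -> 'D_v f x = df.
Proof. by case. Qed.

Lemma derD {W : normedModType R} x v (f g : V -> W) df dg :
  is_derive x v f df -> is_derive x v g dg ->
  is_derive x v (fun y => f y + g y) (df + dg).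
Proof. exact: is_deriveD. Qed.

Lemma derB {W : normedModType R} x v (f g : V -> W) df dg :
  is_derive x v f df -> is_derive x v g dg ->
  is_derive x v (fun y => f y - g y) (df - dg).
Proof. exact: is_deriveB. Qed.

Lemma derM x v f g df dg :
  is_derive x v f df -> is_derive x v g dg ->
  is_derive x v (fun y => f y * g y) (df * g x + f x * dg).
Proof.
move=> Hf Hg; apply: is_derive_eq (is_deriveM Hf Hg) _.
by rewrite /GRing.scale /= addrC (mulrC (g x)).
Qed.

Lemma derC {W : normedModType R} x v (a : W) : is_derive x v (fun=> a) 0.
Proof. exact: is_derive_cst. Qed.

Lemma derN x v f df : is_derive x v f df -> is_derive x v (fun y => - f y) (- df).
Proof. exact: is_deriveN. Qed.

Lemma derX n x v f df : is_derive x v f df ->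
  is_derive x v (fun y => f y ^+ n) (n%:R * f x ^+ n.-1 * df).
Proof.
move=> Hf; elim: n => [|n IH].
  by rewrite mul0r mul0r; exact: derC.
under eq_fun do rewrite exprS.
apply: is_derive_eq (derM Hf IH) _.
case: n {IH} => [|n] /=; first by rewrite !expr0; ring.
by rewrite -[in RHS]addn1 natrD exprS; ring.
Qed.

Lemma derV x v f df : f x != 0 -> is_derive x v f df ->
  is_derive x v (fun y => (f y)^-1) (- df / f x ^+ 2).
Proof.
move=> f0 [Df <-]; apply: DeriveDef; first exact: derivableV.
by rewrite deriveV// /GRing.scale /= mulNr mulrC mulNr.
Qed.

Lemma derComp x v (g : R -> R) f dg df : differentiable f x ->
  is_derive x v f df -> is_derive (f x) 1 g dg ->
  is_derive x v (fun y => g (f y)) (df * dg).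
Proof.
move=> Df [_ <-] [/derivable1_diffP Dg <-].
have Dgf : differentiable (g \o f) x by exact: differentiable_comp.
apply: DeriveDef; first exact: diff_derivable.
rewrite -/(g \o f) (deriveE v Dgf) (diff_comp Df Dg) /= -(deriveE v Df).
by rewrite -[X in 'd g _ X]mulr1 [LHS]linearZ /= -deriveE.
Qed.

End DeriveRules.

Section OneVariable.
Context {R : realType}.
Implicit Types (f : R -> R) (F H : nat -> R -> R) (r x : R).

(** The mean value theorem with end points in either order, possibly equal, for use on segments from
    0 to points of either sign. *)
Lemma MVT_sym (f df : R -> R) (a b : R) :
  (forall z, Num.min a b <= z <= Num.max a b -> {for z, continuous f}) ->
  (forall z, Num.min a b < z < Num.max a b -> is_derive z 1 f (df z)) ->
  exists c, [/\ Num.min a b <= c <= Num.max a b,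
    a != b -> Num.min a b < c < Num.max a b & f b - f a = df c * (b - a)].
Proof.
wlog ab : a b / a <= b => [H cf Hf|].
  case/orP: (le_total a b) => [ab|ba]; first exact: H.
  have [||c [c1 c2 c3]] := H b a ba.
  - by move=> z; rewrite minC maxC; exact: cf.
  - by move=> z; rewrite minC maxC; exact: Hf.
  exists c; rewrite minC maxC eq_sym; split=> //.
  by rewrite -opprB c3 -mulrN opprB.
rewrite min_l// max_r// => cf Hf.
have [->|nab] := eqVneq a b; first by exists b; rewrite lexx !subrr mulr0; split.
have lab : a < b by rewrite lt_neqAle nab.
have Hf' z : z \in `]a, b[%R -> is_derive z 1 f (df z).
  by rewrite in_itv; exact: Hf.
have cf' : {within `[a, b], continuous f}.
  by apply: continuous_in_subspaceT => z; rewrite inE/= in_itv/=; exact: cf.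
have [c] := MVT lab Hf' cf'.
rewrite in_itv/= => /andP[c1 c2] E; exists c; rewrite c1 c2 !ltW//; split=> //.
Qed.

Lemma is_derive_continuous f df x : is_derive x 1 f df -> {for x, continuous f}.
Proof.
by move=> [/derivable1_diffP + _]; exact: differentiable_continuous.
Qed.

(** By the mean value theorem the difference quotient at 0 is [df c] for some c between 0 and h, and
    [df] is continuous at 0. This is how pieces are glued at 0 below. *)
Lemma removable_derive (f df : R -> R) r : 0 < r ->
  (forall x, 0 < `|x| < r -> is_derive x 1 f (df x)) ->
  {for 0, continuous f} -> {for 0, continuous df} ->
  is_derive (0 : R) 1 f (df 0).
Proof.
move=> r0 Hf cf cdf.
suff L : h^-1 *: (f (h *: (1 : R) + 0) - f 0) @[h --> 0^'] --> df 0.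
  by apply: DeriveDef; [apply/cvg_ex; exists (df 0) | exact/cvg_lim].
apply/cvgrPdist_lt => e e0.
move/cvgrPdist_lt: cdf => /(_ e e0) /nbhs_ballP[d /= d0 Hd].
near=> h.
have h0 : h != 0 by near: h; exact: nbhs_dnbhs_neq.
have hr : `|h| < r by near: h; exact: dnbhs0_lt.
have hd : `|h| < d by near: h; exact: dnbhs0_lt.
have ch z : Num.min 0 h <= z <= Num.max 0 h -> `|z| <= `|h|.
  have [? /andP[? ?]|? /andP[? ?]] := lerP 0 h.
    by rewrite !ger0_norm.
  by rewrite ler0_norm// ltr0_norm// lerN2.
have [z Hz|z Hz|c [c1 c2]] := @MVT_sym f df 0 h.
- have [->|z0] := eqVneq z 0; first exact: cf.
  apply: is_derive_continuous (Hf z _).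
  by rewrite normr_gt0 z0 (le_lt_trans (ch _ Hz)).
- apply: Hf; case/andP: (Hz) => z1 z2.
  rewrite (le_lt_trans (ch _ _) hr) ?ltW// andbT normr_gt0.
  by apply/eqP => z0; move: z1 z2; rewrite z0; case: (lerP 0 h); rewrite ltxx.
rewrite subr0 => E; rewrite scaler1 addr0 E /GRing.scale/= mulrCA mulVf// mulr1.
by apply: Hd; rewrite -ball_normE /= sub0r normrN (le_lt_trans (ch _ c1)).
Unshelve. all: by end_near. Qed.

(** A smooth function [F 0] carried along with explicit formulas for all its derivatives. Functions
    defined by cases at 0 are easier to treat in this form than through iterated ['D_1]. *)
Definition tower (U : set R) F :=
  forall n x, U x -> is_derive x 1 (F n) (F n.+1 x).

Lemma derive_scalar f v x : differentiable f x -> 'D_v f x = v * 'D_1 f x.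
Proof.
by move=> df; rewrite !deriveE// -[X in 'd f x X]mulr1 [LHS]linearZ.
Qed.

Lemma tower_Ck U F k n : open U -> tower U F -> Ck k U (F n).
Proof.
move=> oU tF; elim: k n => [|k IH] n /=.
  by move=> x Ux; exact: is_derive_continuous (tF n x Ux).
have Fd x : U x -> differentiable (F n) x.
  by move=> Ux; apply/derivable1_diffP; case: (tF n x Ux).
split=> // v; have cv : Ck k U (fun=> v : R) by exact: Ck_cst.
apply: (Ck_ext oU _ (CkM oU cv (IH n.+1))) => x Ux.
by rewrite (derive_scalar _ (Fd _ Ux)) (is_deriveE (tF n x Ux)).
Qed.

Lemma tower_smooth U F p n : open U -> U p -> tower U F -> smooth_at p (F n).
Proof. by move=> oU Up tF; exists U; split=> // k; exact: tower_Ck. Qed.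

Lemma smooth_tower f : smooth_at 0 f ->
  exists2 r, 0 < r & tower [set x | `|x| < r] (fun n => iter n (fun g : R -> R => 'D_1 g) f).
Proof.
move=> [U [oU U0 cf]].
have := open_nbhs_nbhs (conj oU U0); rewrite -nbhs_ballE => -[r /= r0 rU].
exists r => // n x /= xr.
have cn k : Ck k U (iter n (fun g : R -> R => 'D_1 g) f).
  by elim: n k => [|n IH] k //=; have [_] := IH k.+1; exact.
apply/derivableP/derivable1_diffP.
have [+ _] := cn 1; apply; apply: rU.
by rewrite -ball_normE /= sub0r normrN.
Qed.

End OneVariable.

(** * Hadamard's lemma *)

Section Hadamard.
Context {R : realType}.
Implicit Types (f : R -> R) (F H : nat -> R -> R) (r x : R).

Notation Br r := [set x : R | `|x| < r].

(** The n-th derivative of H(x) = (F(x) - F(0)) / x. Off 0 the recursion is Leibniz's rule for x H =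
    F - F(0), namely x H^(n) + n H^(n-1) = F^(n); the value at 0 is the limit. *)
Fixpoint hquot F (n : nat) x : R :=
  if x == 0 then F n.+1 0 / n.+1%:R else
  match n with
  | 0 => (F 0 x - F 0 0) / x
  | m.+1 => (F n x - n%:R * hquot F m x) / x
  end.

Lemma hquot0 F n : hquot F n 0 = F n.+1 0 / n.+1%:R.
Proof. by case: n => [|n] /=; rewrite eqxx. Qed.

Lemma near_nonzero x : x != 0 -> \forall y \near x, y != 0.
Proof. by apply: (@cvgr_neq0 _ R _ (nbhs x) _ id x); exact: cvg_id. Qed.

Lemma hquot_derive F r n x : tower (Br r) F -> x != 0 -> `|x| < r ->
  is_derive x 1 (hquot F n) (hquot F n.+1 x).
Proof.
move=> tF x0 xr.
have Hinv : is_derive x 1 (fun y => y^-1) (- x^-2 : R).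
  have := derV x0 (is_derive_id x 1); rewrite /= mulN1r.
  exact.
elim: n => [|n IH].
  have Heq : \forall y \near x, (F 0 y - F 0 0) * y^-1 = hquot F 0 y.
    by near=> y; rewrite /= ifN//; near: y; exact: near_nonzero.
  apply: (near_eq_is_derive Heq).
  apply: is_derive_eq (derM (derB (tF 0 x xr) (derC _ _ (F 0 0))) Hinv) _.
  by rewrite /= (negbTE x0); field.
have Heq : \forall y \near x,
    (F n.+1 y - n.+1%:R * hquot F n y) * y^-1 = hquot F n.+1 y.
  by near=> y; rewrite /= ifN//; near: y; exact: near_nonzero.
apply: (near_eq_is_derive Heq).
apply: is_derive_eq
  (derM (derB (tF n.+1 x xr) (derM (derC _ _ (n.+1%:R : R)) IH)) Hinv) _.
rewrite /= (negbTE x0).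
by field.
Unshelve. all: by end_near. Qed.

(** This amounts to x^(n+1) H^(n)(x) being the integral of y^n F^(n+1)(y) from 0 to x. It holds at 0
    too, and it controls H^(n) near 0 without any limit of the quotients. *)
Lemma hquot_primitive F r n x : tower (Br r) F -> `|x| < r ->
  is_derive x 1 (fun y => y ^+ n.+1 * hquot F n y) (x ^+ n * F n.+1 x).
Proof.
move=> tF xr; elim: n => [|n IH].
  have -> : (fun y => y ^+ 1 * hquot F 0 y) = (fun y => F 0 y - F 0 0).
    apply/funext => y /=; rewrite expr1; case: eqVneq => [->|y0].
      by rewrite mul0r subrr.
    by rewrite mulrCA mulfV ?mulr1.
  by apply: is_derive_eq (derB (tF 0 x xr) (derC _ _ (F 0 0))) _;
    rewrite expr0 mul1r subr0.
have -> : (fun y => y ^+ n.+2 * hquot F n.+1 y) =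
    (fun y => y ^+ n.+1 * F n.+1 y - n.+1%:R * (y ^+ n.+1 * hquot F n y)).
  apply/funext => y /=; case: eqVneq => [->|y0].
    by rewrite !expr0n /= !mul0r mulr0 subr0.
  by rewrite (exprS y n.+1); field.
have Hx := derX n.+1 (is_derive_id x (1 : R)).
apply: is_derive_eq
  (derB (derM Hx (tF n.+1 x xr)) (derM (derC _ _ (n.+1%:R : R)) IH)) _.
rewrite /=; ring.
Qed.

Lemma hquot_continuous0 F r n : 0 < r -> tower (Br r) F ->
  {for 0, continuous (hquot F n)}.
Proof.
move=> r0 tF.
have cF : {for 0, continuous (F n.+1)}.
  by apply: is_derive_continuous (tF n.+1 0 _); rewrite /= normr0.
apply/cvgrPdist_lt => e e0.
move/cvgrPdist_lt: cF => /(_ e e0) /nbhs_ballP[d /= d0 Hd].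
have nr : \forall x \near (0 : R), `|x| < r by exact: nbhs0_lt.
have nd : \forall x \near (0 : R), `|x| < d by exact: nbhs0_lt.
near=> x.
have [->|x0] := eqVneq x 0; first by rewrite subrr normr0.
have xr : `|x| < r by near: x; exact: nr.
have xd : `|x| < d by near: x; exact: nd.
have cx (z : R) : Num.min 0 x <= z <= Num.max 0 x -> `|z| <= `|x|.
  have [? /andP[? ?]|? /andP[? ?]] := lerP 0 x.
    by rewrite !ger0_norm.
  by rewrite ler0_norm// ltr0_norm// lerN2.
(* The derivative of [E] is z^n (F^(n+1)(z) - F^(n+1)(0)). The mean value theorem bounds [E x] by e
   |x|^(n+1), and division by |x|^(n+1) gives the claim. *)
pose E y := y ^+ n.+1 * hquot F n y - y ^+ n.+1 * (F n.+1 0 / n.+1%:R).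
have dE (z : R) : `|z| < r -> is_derive z 1 E (z ^+ n * (F n.+1 z - F n.+1 0)).
  move=> zr; have Hx := derX n.+1 (is_derive_id z (1 : R)).
  apply: is_derive_eq (derB (hquot_primitive n tF zr)
    (derM Hx (derC _ _ (F n.+1 0 / n.+1%:R)))) _.
  by rewrite /=; field; rewrite addrC natr1 pnatr_eq0.
have [z Hz|z Hz|c [c1 _]] := @MVT_sym R E (fun z => z ^+ n * (F n.+1 z - F n.+1 0)) 0 x.
- exact: is_derive_continuous (dE z (le_lt_trans (cx _ Hz) xr)).
- apply: dE; case/andP: Hz => ? ?.
  by rewrite (le_lt_trans (cx _ _) xr)// !ltW.
rewrite subr0 {1 2}/E !expr0n /= !mul0r subrr subr0 -mulrBr => Ex.
have He : `|F n.+1 c - F n.+1 0| < e.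
  by rewrite distrC; apply: Hd; rewrite -ball_normE /= sub0r normrN
    (le_lt_trans (cx _ c1)).
have xn0 : 0 < `|x| by rewrite normr_gt0.
rewrite hquot0 distrC -(ltr_pM2l (exprn_gt0 n.+1 xn0)).
rewrite -normrX -normrM Ex !normrM !normrX exprSr [ltRHS]mulrAC ltr_pM2r//.
rewrite (@le_lt_trans _ _ (`|x| ^+ n * `|F n.+1 c - F n.+1 0|))//.
  by rewrite ler_wpM2r// lerXn2r ?nnegrE// cx.
by rewrite ltr_pM2l// exprn_gt0.
Unshelve. all: by end_near. Qed.

(** Off 0 the tower relation is the quotient rule; at 0 it follows from the continuity of each
    [hquot F n] by [removable_derive]. *)
Lemma hadamard_tower F r : 0 < r -> tower (Br r) F ->
  exists H, [/\ tower (Br r) H, forall x, F 0 x = F 0 0 + x * H 0 x &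
    forall n, H n 0 = F n.+1 0 / n.+1%:R].
Proof.
move=> r0 tF; exists (hquot F); split => [n x xr|x|n]; last exact: hquot0.
- have [->|x0] := eqVneq x 0; last exact: hquot_derive tF x0 xr.
  apply: (@removable_derive _ _ _ r) => //; try exact: hquot_continuous0 tF.
  by move=> y /andP[y0 yr]; apply: hquot_derive tF _ yr; rewrite -normr_gt0.
- rewrite /=; case: eqVneq => [->|x0]; first by rewrite mul0r addr0.
  by rewrite mulrCA mulfV// mulr1 addrC subrK.
Qed.

End Hadamard.

(** * Borel's lemma *)

Section SeriesDerivative.
Context {R : realType} (t : nat -> nat -> R -> R) (B : nat -> R).
Hypothesis tB : forall k n (s : R), s <= 0 -> `|t k n s| <= B n * 2^-1 ^+ k.
Hypothesis td : forall k n (s : R), is_derive s 1 (t k n) (t k n.+1 s).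

(** Meaningful for s <= 0, where a geometric series dominates the terms. *)
Definition sum_tower n (s : R) := limn (series (fun k => t k n s)).

Lemma sum_tower_cvg n (s : R) : s <= 0 -> series (fun k => t k n s) @ \oo --> sum_tower n s.
Proof.
move=> s0; apply: normed_cvg.
apply: (series_le_cvg (v_ := geometric (B n) 2^-1)).
- by move=> k; exact: normr_ge0.
- by move=> k; apply: le_trans (tB k n s0).
- by move=> k; exact: tB.
- by apply: is_cvg_geometric_series; rewrite ger0_norm ?invf_lt1 ?ltr1n.
Qed.

(** The mean value theorem is used twice: first for the term minus its linear part, then for the
    derivative [t k n.+1]. *)
Lemma term_taylor k n (s s' : R) : s <= 0 -> s' <= 0 ->
  `|t k n s' - t k n s - (s' - s) * t k n.+1 s| <=
  B n.+2 * 2^-1 ^+ k * (s' - s) ^+ 2.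
Proof.
move=> s0 s'0.
have [|z _|c [c1 _ Ec]] := @MVT_sym R (fun z => t k n z - z * t k n.+1 s)
    (fun z => t k n.+1 z - t k n.+1 s) s s'.
- move=> z _; apply: (@is_derive_continuous _ _ (t k n.+1 z - t k n.+1 s)).
  apply: is_derive_eq (derB (td k n z) (derM (is_derive_id z (1 : R)) (derC _ _ (t k n.+1 s)))) _.
  by rewrite mul1r mulr0 addr0.
- apply: is_derive_eq (derB (td k n z) (derM (is_derive_id z (1 : R)) (derC _ _ (t k n.+1 s)))) _.
  by rewrite mul1r mulr0 addr0.
have [c0 cs] : c <= 0 /\ `|c - s| <= `|s' - s|.
  case: (lerP s s') c1 => ss' /andP[c1 c2]; split; try lra.
    by rewrite !ger0_norm; lra.
  by rewrite !ler0_norm; lra.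
have ct z : {for z, continuous (t k n.+1)}.
  exact: is_derive_continuous (td k n.+1 z).
have [d [d1 _ Ed]] := @MVT_sym R (t k n.+1) (t k n.+2) s c
  (fun z _ => ct z) (fun z _ => td k n.+1 z).
have d0 : d <= 0.
  by case: (lerP s c) d1 => ss' /andP[d1 d2]; lra.
have -> : t k n s' - t k n s - (s' - s) * t k n.+1 s =
   t k n s' - s' * t k n.+1 s - (t k n s - s * t k n.+1 s) by ring.
rewrite Ec Ed !normrM -mulrA ler_pM// ?mulr_ge0//; first exact: tB.
by rewrite -[leRHS]real_normK ?num_real// expr2 ler_wpM2r.
Qed.

(** Term-by-term differentiation in quantitative form: the quadratic remainders are summed over k,
    and the powers of 1/2 add up to at most 2. *)
Lemma sum_tower_taylor n (s s' : R) : s <= 0 -> s' <= 0 ->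
  `|sum_tower n s' - sum_tower n s - (s' - s) * sum_tower n.+1 s| <=
  B n.+2 * 2 * (s' - s) ^+ 2.
Proof.
move=> s0 s'0.
have L : (fun N => series (fun k => t k n s') N - series (fun k => t k n s) N -
      (s' - s) * series (fun k => t k n.+1 s) N) @ \oo -->
    sum_tower n s' - sum_tower n s - (s' - s) * sum_tower n.+1 s.
  apply: cvgB; first by apply: cvgB; exact: sum_tower_cvg.
  by apply: cvgMr; exact: sum_tower_cvg.
have L1 := cvg_norm L; have L' := L1 eventually_filter.
rewrite -(cvg_lim _ L')//.
apply: limr_le; first by apply/cvg_ex; eexists; exact: L'.
apply: nearW => N; rewrite /series /=.
rewrite mulr_sumr -!sumrB (le_trans (ler_norm_sum _ _ _))//.
have B0 : 0 <= B n.+2.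
  by have := tB 0 n.+2 (lexx 0); rewrite expr0 mulr1; exact: le_trans.
apply: (@le_trans _ _ (\sum_(0 <= k < N) B n.+2 * 2^-1 ^+ k * (s' - s) ^+ 2)).
  by apply: ler_sum => k _; exact: term_taylor.
rewrite -mulr_suml ler_wpM2r ?sqr_ge0// -mulr_sumr ler_wpM2l//.
have := @geometric_seriesE R 1 2^-1.
rewrite /series => /(_ _)/(congr1 (fun f => f N)) /=.
under eq_bigr do rewrite mul1r.
move=> ->; last by rewrite lt_eqF// invf_lt1 ?ltr1n.
rewrite [X in _ / X](_ : _ = 2^-1); last by field.
by rewrite invrK mul1r ler_piMl// lerBlDr lerDl exprn_ge0.
Qed.

End SeriesDerivative.

Lemma quadratic_is_derive {R : realType} (f : R -> R) (s d C e : R) : 0 < e ->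
  (forall h, `|h| < e -> `|f (s + h) - f s - h * d| <= C * h ^+ 2) ->
  is_derive s 1 f d.
Proof.
move=> e0 Hf.
suff L : h^-1 *: (f (h *: (1 : R) + s) - f s) @[h --> 0^'] --> d.
  by apply: DeriveDef; [apply/cvg_ex; exists d | exact/cvg_lim].
apply/cvgrPdist_lt => eps eps0.
have C1 : 0 < `|C| + 1 by rewrite ltr_wpDl.
near=> h.
have h0 : h != 0 by near: h; exact: nbhs_dnbhs_neq.
have he : `|h| < e by near: h; exact: dnbhs0_lt.
have hc : `|h| < eps / (`|C| + 1) by near: h; apply: dnbhs0_lt; rewrite divr_gt0.
rewrite -normrN opprB -(@ltr_pM2l _ `|h|) ?normr_gt0// -normrM mulrBr.
rewrite /GRing.scale/= mulVKf// mulr1 [h + s]addrC.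
apply: (le_lt_trans (Hf h he)); rewrite -real_normK ?num_real// expr2 mulrCA.
rewrite ltr_pM2l ?normr_gt0//.
apply: (@le_lt_trans _ _ ((`|C| + 1) * `|h|)).
  by rewrite ler_wpM2r// (le_trans (ler_norm C))// lerDl.
by rewrite mulrC -ltr_pdivlMr.
Unshelve. all: by end_near. Qed.

(** * Prescribed derivatives at 0, from the left *)

Section BorelLeft.
Context {R : realType}.

(** The Euler operator y d/dy: the derivative of p(exp(s / e)) in s is 1/e times ([theta] p)(exp(s /
    e)). *)
Definition theta (p : {poly R}) : {poly R} := 'X * p^`().

Definition pnorm (p : {poly R}) : R := \sum_(i < size p) `|p`_i|.

Lemma pnorm_ge0 p : 0 <= pnorm p.
Proof. by apply: sumr_ge0. Qed.

Lemma horner_pnorm (p : {poly R}) y : 0 <= y <= 1 -> `|p.[y]| <= pnorm p.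
Proof.
move=> /andP[y0 y1]; rewrite horner_coef (le_trans (ler_norm_sum _ _ _))//.
apply: ler_sum => i _; rewrite normrM ler_piMr//.
by rewrite normrX ger0_norm// exprn_ile1.
Qed.

Definition bpoly k n : {poly R} := iter n theta (('X - 1) ^+ k).

(** Each application of [theta] lowers the multiplicity of the root 1 by one. The point 1 matters
    because it is the value of exp(s / e) at s = 0. *)
Lemma bpoly_factor k n : (n <= k)%N ->
  exists2 q, bpoly k n = ('X - 1) ^+ (k - n) * q & q.[1] = (k ^_ n)%:R.
Proof.
elim: n => [|n IH] nk.
  by exists 1; rewrite ?subn0 ?mulr1// ffactn0 hornerC.
have [q Eq q1] := IH (ltnW nk).
exists ('X * (q *+ (k - n) + ('X - 1) * q^`())).
  rewrite /bpoly iterS -/(bpoly k n) Eq /theta derivM deriv_exp derivB derivX derivC subr0.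
  have -> : (k - n = (k - n.+1).+1)%N by rewrite subnSK.
  rewrite /= exprS mul1r mulrnAl -[RHS]mulrCA; congr (_ * _).
  by rewrite mulrDr mulrnAr mulrCA mulrA.
by rewrite !hornerE hornerMn q1 subrr mul0r addr0 ffactnSr natrM mulr_natr.
Qed.

Lemma bpoly1_lt k n : (n < k)%N -> (bpoly k n).[1] = 0.
Proof.
move=> nk; have [q -> _] := bpoly_factor (ltnW nk).
by rewrite !hornerE subrr expr0n subn_eq0 leqNgt nk mul0r.
Qed.

Lemma bpoly1_diag k : (bpoly k k).[1] = k`!%:R.
Proof.
have [q -> q1] := bpoly_factor (leqnn k).
by rewrite subnn expr0 mul1r q1 ffactnn.
Qed.

(** Chosen so that e |c| [pnorm (bpoly k n)] <= 2^(-k) for all n < k; the summand 1 makes it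
    positive and at most 1. *)
Definition bscale k (c : R) : R :=
  (1 + 2 ^+ k * (`|c| * \sum_(n < k) pnorm (bpoly k n)))^-1.

(* The [n]-th derivative of [c * (e * (exp (s / e) - 1)) ^ k], where [e] is the
   scale [bscale k c].  It is a polynomial in [exp (s / e)], which lies in [0, 1] as
   [s <= 0]; hence for small [e] it is small if [n < k], and it then vanishes at [0]. *)
Definition bterm k (c : R) n s : R :=
  c * bscale k c ^+ k / bscale k c ^+ n * (bpoly k n).[expR (s / bscale k c)].

Lemma bscale_den_ge1 k (c : R) :
  1 <= 1 + 2 ^+ k * (`|c| * \sum_(n < k) pnorm (bpoly k n)).
Proof.
by rewrite lerDl mulr_ge0 ?exprn_ge0// mulr_ge0// sumr_ge0// => n _; exact: pnorm_ge0.
Qed.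

Lemma bscale_gt0 k c : 0 < bscale k c.
Proof. by rewrite invr_gt0 (lt_le_trans _ (bscale_den_ge1 k c)). Qed.

Lemma bscale_le1 k c : bscale k c <= 1.
Proof. by rewrite invf_le1 ?bscale_den_ge1// (lt_le_trans _ (bscale_den_ge1 k c)). Qed.

Lemma bterm_derive k c n (s : R) : is_derive s 1 (bterm k c n) (bterm k c n.+1 s).
Proof.
have e0 : bscale k c != 0 by rewrite gt_eqF// bscale_gt0.
set e := bscale k c in e0 *.
have He : is_derive s 1 (fun y => y * e^-1) (e^-1).
  apply: is_derive_eq (derM (is_derive_id s (1 : R)) (derC _ _ e^-1)) _.
  by rewrite mul1r mulr0 addr0.
have Hexp : is_derive s 1 (fun y => expR (y * e^-1)) (e^-1 * expR (s / e)).
  apply: (derComp _ He (is_derive_expR _)).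
  by apply/derivable1_diffP; case: He.
have Hp : is_derive s 1 (fun y => (bpoly k n).[expR (y * e^-1)])
    (e^-1 * expR (s / e) * (bpoly k n)^`().[expR (s / e)]).
  apply: (derComp _ Hexp (is_derive_poly _ _)).
  by apply/derivable1_diffP; case: Hexp.
apply: is_derive_eq (derM (derC _ _ (c * e ^+ k / e ^+ n)) Hp) _.
rewrite mul0r add0r /bterm -/e /bpoly iterS -/(bpoly k n) /theta hornerM hornerX.
by rewrite exprS invfM; ring.
Qed.

Lemma bterm_bound k c n (s : R) : s <= 0 ->
  `|bterm k c n s| <= `|c| * bscale k c ^+ k / bscale k c ^+ n * pnorm (bpoly k n).
Proof.
have e0 := bscale_gt0 k c; move=> s0.
rewrite /bterm normrM ler_pM//.
  by rewrite !normrM normfV !normrX (gtr0_norm e0).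
apply: horner_pnorm; rewrite expR_ge0 expR_le1.
by rewrite andTb pmulr_lle0 // invr_gt0.
Qed.

(** The n-th derivative carries the factor e^(k-n), which is at most e since n < k and e <= 1; the
    choice of [bscale] does the rest. *)
Lemma bterm_small k c n (s : R) : (n < k)%N -> s <= 0 -> `|bterm k c n s| <= 2^-1 ^+ k.
Proof.
move=> nk s0; have e0 := bscale_gt0 k c.
apply: (le_trans (bterm_bound k c n s0)).
apply: (@le_trans _ _ (`|c| * bscale k c * \sum_(n < k) pnorm (bpoly k n))).
  rewrite ler_pM ?pnorm_ge0//.
  - by rewrite mulr_ge0 ?invr_ge0 ?exprn_ge0 ?mulr_ge0 ?exprn_ge0// ltW.
  - rewrite -mulrA ler_wpM2l// -expfB// -[leRHS]expr1.
    by rewrite ler_wiXn2l ?bscale_le1 ?subn_gt0// ltW.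
  - rewrite (bigD1 (Ordinal nk))//= lerDl sumr_ge0// => m _; exact: pnorm_ge0.
rewrite mulrAC /bscale exprVn ler_pdivrMr ?(lt_le_trans _ (bscale_den_ge1 k c))//.
by rewrite mulrDr mulr1 mulKf ?gt_eqF ?exprn_gt0// lerDr invr_ge0 exprn_ge0.
Qed.

(** The list of the first k coefficients, since each depends on all previous ones. Terms before the
    k-th also contribute to the k-th derivative at 0; the new coefficient corrects their sum to
    [a k], the k-th derivative of the k-th term being k! times its coefficient. *)
Fixpoint bcoefs (a : nat -> R) k : seq R :=
  if k is k'.+1 then
    let l := bcoefs a k' in
    rcons l ((a k' - \sum_(j < k') bterm j l`_j k' 0) / k'`!%:R)
  else [::].

Definition bcoef a k : R := (bcoefs a k.+1)`_k.

Lemma size_bcoefs a k : size (bcoefs a k) = k.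
Proof. by elim: k => //= k IH; rewrite size_rcons IH. Qed.

Lemma nth_bcoefs a k j : (j < k)%N -> (bcoefs a k)`_j = bcoef a j.
Proof.
elim: k => // k IH; rewrite ltnS leq_eqVlt => /predU1P[->//|jk].
by rewrite /= nth_rcons size_bcoefs jk IH.
Qed.

Lemma bterm0_diag k c : bterm k c k 0 = c * k`!%:R.
Proof.
by rewrite /bterm mul0r expR0 bpoly1_diag mulfK// gt_eqF// exprn_gt0// bscale_gt0.
Qed.

Lemma bterm_sum a n : \sum_(k < n.+1) bterm k (bcoef a k) n 0 = a n.
Proof.
rewrite big_ord_recr /= bterm0_diag {2}/bcoef /= nth_rcons size_bcoefs ltnn eqxx.
rewrite divfK ?pnatr_eq0 -?lt0n ?fact_gt0//.
under [X in _ + (_ - X)]eq_bigr => j _ do rewrite nth_bcoefs//.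
by rewrite addrC subrK.
Qed.

(** The functions are the sums of the series of [bterm]. The last clause gives continuity at 0 from
    the left, as needed for gluing with a function on the right. *)
Lemma borel_left (a : nat -> R) : exists G : nat -> R -> R,
  [/\ forall n, G n 0 = a n,
      forall n (s : R), s < 0 -> is_derive s 1 (G n) (G n.+1 s) &
      forall n, exists M, forall s, -1 <= s <= 0 -> `|G n s - G n 0| <= M * `|s|].
Proof.
pose t k n s := bterm k (bcoef a k) n s.
pose bd k n := `|bcoef a k| * bscale k (bcoef a k) ^+ k / bscale k (bcoef a k) ^+ n
  * pnorm (bpoly k n).
have bd0 k n : 0 <= bd k n.
  have e0 := bscale_gt0 k (bcoef a k).
  by rewrite mulr_ge0 ?pnorm_ge0 ?mulr_ge0 ?invr_ge0 ?exprn_ge0 ?mulr_ge0 ?exprn_ge0// ltW.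
(* The finitely many terms with k <= n are absorbed into the sum; the summand 1 serves those with k
   > n, by [bterm_small]. *)
pose B n := 1 + \sum_(k < n.+1) 2 ^+ k * bd k n.
have tB k n (s : R) : s <= 0 -> `|t k n s| <= B n * 2^-1 ^+ k.
  move=> s0; have [kn|nk] := leqP k n.
    apply: (le_trans (bterm_bound k _ n s0)); rewrite -/(bd k n).
    rewrite exprVn ler_pdivlMr ?exprn_gt0// mulrC /B.
    rewrite (bigD1 (Ordinal (kn : (k < n.+1)%N)))//= addrCA lerDl.
    by rewrite addr_ge0// sumr_ge0// => j _; rewrite mulr_ge0// exprn_ge0.
  apply: (le_trans (bterm_small _ nk s0)); rewrite ler_peMl ?exprn_ge0 ?invr_ge0//.
  by rewrite lerDl sumr_ge0// => j _; rewrite mulr_ge0// exprn_ge0.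
have td k n (s : R) : is_derive s 1 (t k n) (t k n.+1 s) by exact: bterm_derive.
have T n s s' := @sum_tower_taylor R t B tB td n s s'.
exists (sum_tower t); split.
- move=> n; rewrite -(bterm_sum a n); apply/cvg_lim => //.
  (* At s = 0 the terms with k > n vanish to order higher than n, so the partial sums are constant
     from n + 1 on. *)
  apply: (cvg_near_cst); exists n.+1 => // N /= nN.
  rewrite /series /= -(subnKC nN) big_mkord big_split_ord /=.
  rewrite [X in _ + X]big1 ?addr0// => j _.
  rewrite /t /bterm mul0r expR0 bpoly1_lt ?mulr0//.
  by rewrite ltn_addr.
- move=> n s s0; apply: (@quadratic_is_derive _ _ _ _ (B n.+2 * 2) (- s)).
    by rewrite oppr_gt0.
  move=> h hs; have := T n s (s + h) (ltW s0) _.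
  have -> : s + h - s = h by ring.
  apply.
  by have := ler_norm h; lra.
- move=> n; exists (`|sum_tower t n.+1 0| + B n.+2 * 2) => s /andP[s1 s0].
  have := T n 0 s (lexx _) s0; rewrite subr0 => H.
  rewrite -[X in `|X|](subrK (s * sum_tower t n.+1 0)).
  rewrite (le_trans (ler_normD _ _))// mulrDl addrC normrM mulrC lerD//.
  apply: (le_trans H); rewrite ler_wpM2l//.
    have := tB 0%N n.+2 0 (lexx _); rewrite expr0 mulr1 => h.
    by rewrite mulr_ge0// (le_trans _ h).
  by rewrite -real_normK ?num_real// expr2 ler_piMr// ler_norml; lra.
Qed.

End BorelLeft.

(** * Whitney's theorem on even functions *)

Section Whitney.
Context {R : realType}.
Implicit Types (f : R -> R) (F H : nat -> R -> R) (r x : R).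

Notation Br r := [set x : R | `|x| < r].

Lemma open_Br r : open (Br r).
Proof.
rewrite (_ : Br r = ball (0 : R) r); first exact: ball_open.
by apply/seteqP; split => x; rewrite -ball_normE /= sub0r normrN.
Qed.

Arguments open_Br : clear implicits.

Lemma near_Br r x : `|x| < r -> \forall y \near x, `|y| < r.
Proof.
move=> xr; suff : nbhs x (Br r) by [].
by apply: open_nbhs_nbhs; split=> //; exact: open_Br.
Qed.

Lemma tower_iter U F n x : open U -> tower U F -> U x ->
  iter n (fun g : R -> R => 'D_1 g) (F 0) x = F n x.
Proof.
move=> oU tF; elim: n x => // n IH x Ux; rewrite iterS.
rewrite -(is_deriveE (tF n x Ux)).
by apply: near_eq_derive; apply: filterS (open_nbhs_nbhs (conj oU Ux)) => y; exact: IH.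
Qed.

Lemma tower_opp r F : tower (Br r) F ->
  tower (Br r) (fun n x => (-1) ^+ n * F n (- x)).
Proof.
move=> tF n x xr; have nx : Br r (- x) by rewrite /= normrN.
have HN : is_derive x 1 (fun y : R => - y) (-1).
  by apply: derN; exact: is_derive_id.
have HF : is_derive x 1 (fun y => F n (- y)) (- 1 * F n.+1 (- x)).
  apply: (derComp _ HN (tF n _ nx)); by apply/derivable1_diffP; case: HN.
apply: is_derive_eq (derM (derC _ _ ((-1) ^+ n : R)) HF) _.
by rewrite exprS; ring.
Qed.

Lemma tower_lin r (a b : R) F H : tower (Br r) F -> tower (Br r) H ->
  tower (Br r) (fun n x => a * F n x + b * H n x).
Proof.
move=> tF tH n x xr.
apply: is_derive_eq (derD (derM (derC _ _ a) (tF n x xr))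
  (derM (derC _ _ b) (tH n x xr))) _.
by rewrite !mul0r !add0r.
Qed.

Definition even_tower r F :=
  tower (Br r) F /\ forall x, `|x| < r -> F 0 (- x) = F 0 x.

(* [H 0] is [t |-> F' t / (2 t)], the derivative of [F] with respect to [t ^ 2]. *)
Lemma even_tower_step r F : 0 < r -> even_tower r F ->
  exists2 H, even_tower r H & forall x, `|x| < r -> F 1 x = 2 * x * H 0 x.
Proof.
move=> r0 [tF eF].
have oF x : `|x| < r -> F 1 (- x) = - F 1 x.
  move=> xr; have HF := @tower_opp _ _ tF 0%N x xr.
  have : is_derive x 1 (F 0) ((-1) ^+ 1 * F 1 (- x)).
    apply: near_eq_is_derive HF.
    apply: filterS (near_Br xr) => y yr; by rewrite expr0 mul1r eF.
  move=> /is_deriveE; rewrite (is_deriveE (tF 0 x xr)).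
  by move=> ->; rewrite expr1 mulN1r opprK.
have F10 : F 1 0 = 0.
  have := oF 0; rewrite normr0 oppr0 => /(_ r0) h; lra.
have tF1 : tower (Br r) (fun n => F n.+1) by move=> n x xr; exact: tF.
have [H [tH HE _]] := hadamard_tower r0 tF1.
rewrite /= F10 in HE.
(* The zero summand puts half of [H] in the form handled by [tower_lin]. *)
exists (fun n x => 2^-1 * H n x + 0 * H n x); first split; first exact: tower_lin.
- move=> x xr; have [->|x0] := eqVneq x 0; first by rewrite oppr0.
  have := oF x xr; rewrite !HE !add0r mulNr => /oppr_inj/(mulfI x0) ->//.
- by move=> x xr; rewrite HE; field.
Qed.

(** [E m 0] at t is to become the m-th derivative of A at t^2. The step is iterated by choice, over
    functions packed with the proof that they are even. *)
Lemma even_towers r F : 0 < r -> even_tower r F ->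
  exists E : nat -> nat -> R -> R, [/\ E 0 = F, forall m, even_tower r (E m) &
    forall m x, `|x| < r -> E m 1 x = 2 * x * E m.+1 0 x].
Proof.
move=> r0 eF.
pose S := {F | even_tower r F}.
have /choice[s Hs] : forall A : S, exists A' : S,
    forall x, `|x| < r -> sval A 1 x = 2 * x * sval A' 0 x.
  by move=> [A eA]; have [A' eA' ?] := even_tower_step r0 eA; exists (exist _ A' eA').
exists (fun m => sval (iter m s (exist _ F eF))); split=> // m.
  by case: (iter m s _).
exact: Hs.
Qed.

(** For s > 0 the chain rule turns the relation between [E m] and [E m.+1] into: the derivative of
    [E m 0] at sqrt s is [E m.+1 0] at sqrt s. For s <= 0 the Borel tower with the values [E n 0 0]
    at 0 takes over. *)
Lemma whitney_even_tower r F : 0 < r -> even_tower r F ->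
  exists A, tower (Br (r ^+ 2)) A /\ forall t, `|t| < r -> F 0 t = A 0 (t ^+ 2).
Proof.
move=> r0 eF; have [E [E0 eE HE]] := even_towers r0 eF.
have [G [G0 dG cG]] := borel_left (fun n => E n 0 0).
have {}G0 n : G n 0 = E n 0 0 by exact: G0.
have rr0 : 0 < r ^+ 2 by rewrite exprn_gt0.
pose A n (s : R) := if 0 < s then E n 0 (Num.sqrt s) else G n s.
have A0 n : A n 0 = E n 0 0 by rewrite /A ltxx G0.
have sqrt_lt (s : R) : `|s| < r ^+ 2 -> `|Num.sqrt s| < r.
  move=> sr; rewrite ger0_norm ?sqrtr_ge0//.
  by rewrite -[ltRHS](gtr0_norm r0) -sqrtr_sqr ltr_sqrt// (le_lt_trans (ler_norm s)).
have Apos n (s : R) : 0 < s -> `|s| < r ^+ 2 -> is_derive s 1 (A n) (A n.+1 s).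
  move=> s0 sr.
  have Heq : \forall y \near s, E n 0 (Num.sqrt y) = A n y.
    by near=> y; rewrite /A ifT//; near: y; exact: lt_nbhsr.
  apply: (near_eq_is_derive Heq).
  have Hs := is_derive1_sqrt s0.
  have [tE _] := eE n.
  have := derComp _ Hs (tE 0%N _ (sqrt_lt s sr)).
  move=> /(_ _)/is_derive_eq; apply.
    by apply/derivable1_diffP; case: Hs.
  rewrite HE ?sqrt_lt// /A s0 mulrA mulVf ?mul1r// mulf_neq0//.
  by rewrite gt_eqF// sqrtr_gt0.
have Aneg n (s : R) : s < 0 -> is_derive s 1 (A n) (A n.+1 s).
  move=> s0.
  have Heq : \forall y \near s, G n y = A n y.
    near=> y; rewrite /A ifN// -leNgt ltW//; near: y; exact: lt_nbhsl.
  apply: (near_eq_is_derive Heq).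
  have -> : A n.+1 s = G n.+1 s by rewrite /A ifN// -leNgt ltW.
  exact: dG.
have cA n : {for 0, continuous (A n)}.
  have cE : {for 0, continuous (E n 0)}.
    have [tE _] := eE n.
    by apply: is_derive_continuous (tE 0%N 0 _); rewrite /= normr0.
  have csq : E n 0 (Num.sqrt s) @[s --> (0 : R)] --> E n 0 0.
    have cs : Num.sqrt s @[s --> (0 : R)] --> (0 : R).
      by rewrite -[X in _ --> X]sqrtr0; exact: sqrt_continuous.
    exact: (cvg_comp _ _ cs cE).
  have [M HM] := cG n.
  suff : A n s @[s --> (0 : R)] --> A n 0 by [].
  apply/cvgrPdist_lt => e e0; rewrite A0.
  have M1 : 0 < `|M| + 1 by rewrite ltr_wpDl.
  have n1 : \forall s \near (0 : R), `|E n 0 0 - E n 0 (Num.sqrt s)| < e.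
    by move/cvgrPdist_lt: csq => /(_ e e0).
  have n2 : \forall s \near (0 : R), `|s| < e / (`|M| + 1).
    by apply: nbhs0_lt; rewrite divr_gt0.
  have n3 : \forall s \near (0 : R), `|s| < 1 by exact: nbhs0_lt.
  near=> s.
  have h1 : `|E n 0 0 - E n 0 (Num.sqrt s)| < e by near: s; exact: n1.
  have h2 : `|s| < e / (`|M| + 1) by near: s; exact: n2.
  have h3 : `|s| < 1 by near: s; exact: n3.
  rewrite /A; case: (ltP 0 s) => // s0.
  rewrite -(G0 n) distrC; apply: le_lt_trans (HM s _) _.
    by rewrite s0 andbT; have := ler_norm (- s); rewrite normrN; lra.
  apply: (@le_lt_trans _ _ ((`|M| + 1) * `|s|)).
    by rewrite ler_wpM2r// (le_trans (ler_norm M))// lerDl.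
  by rewrite mulrC -ltr_pdivlMr.
exists A; split=> [n s /= sr|t tr].
  have [s0|s0|->] := ltgtP s 0; first exact: Aneg; first exact: Apos.
  (* The two halves agree at 0 in every order, so each [A n] is continuous there and the derivative
     extends across 0. *)
  apply: (removable_derive rr0 _ (cA n) (cA n.+1)) => x /andP[].
  rewrite normr_gt0.
  by case: (ltgtP x 0) => // x0 _ xr; [exact: Aneg | exact: Apos].
rewrite /A; have [_ eE0] := eF; rewrite -E0 in eE0 *.
have [->|t0] := eqVneq t 0; first by rewrite expr0n /= ltxx G0.
rewrite exprn_even_gt0//= t0 sqrtr_sqr.
by case: (ger0P t) => // _; rewrite eE0.
Unshelve. all: by end_near. Qed.

Lemma whitney f : smooth_at 0 f -> exists C D : R -> R,
  [/\ smooth_at 0 C, smooth_at 0 D, C 0 = f 0 &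
      \forall t \near (0 : R), f t = C (t ^+ 2) + t * D (t ^+ 2)].
Proof.
move=> /smooth_tower[r r0].
pose F n := iter n (fun g : R -> R => 'D_1 g) f.
rewrite -/F => tF; have tN := tower_opp tF.
have rr0 : `|0 : R| < r ^+ 2 by rewrite normr0 exprn_gt0.
have HD (A : nat -> R -> R) : tower (Br (r ^+ 2)) A -> smooth_at 0 (A 0).
  by move=> tA; exact: (tower_smooth 0 (open_Br _) rr0 tA).
(* The even part of [f], with its derivatives. *)
pose Fe n x := 2^-1 * F n x + 2^-1 * ((-1) ^+ n * F n (- x)).
have eFe : even_tower r Fe.
  split=> [|x _]; first exact: tower_lin.
  by rewrite /Fe opprK !expr0 !mul1r addrC.
have [A [tA EA]] := whitney_even_tower r0 eFe.
(* The odd part of [f]. It vanishes at 0, so it is x times a smooth function, which is even. *)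
pose Fo n x := 2^-1 * F n x + - 2^-1 * ((-1) ^+ n * F n (- x)).
have [H [tH HE _]] := hadamard_tower r0 (tower_lin 2^-1 (- 2^-1) tF tN : tower _ Fo).
have {}HE x : 2^-1 * (F 0 x - F 0 (- x)) = x * H 0 x.
  by have := HE x; rewrite /Fo oppr0 !expr0; lra.
have eH : even_tower r H.
  split=> // x xr; have [->|x0] := eqVneq x 0; first by rewrite oppr0.
  by apply: (mulfI x0); have := HE x; have := HE (- x); rewrite opprK; lra.
have [B [tB EB]] := whitney_even_tower r0 eH.
have E : \forall t \near (0 : R), f t = A 0 (t ^+ 2) + t * B 0 (t ^+ 2).
  have B0 : `|0 : R| < r by rewrite normr0.
  apply: filterS (near_Br B0) => t tr.
  rewrite -EA// -EB//; have := HE t.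
  by rewrite /Fe expr0 (_ : F 0 = f)//; lra.
exists (A 0), (B 0); split; [exact: HD | exact: HD | | exact: E].
by rewrite (nbhs_singleton E) expr0n /= mul0r addr0.
Qed.

Lemma hadamard f : smooth_at 0 f -> f 0 = 0 ->
  exists g, [/\ smooth_at 0 g, forall x, f x = x * g x &
    forall n, iter n (fun g : R -> R => 'D_1 g) g 0 =
      iter n.+1 (fun g : R -> R => 'D_1 g) f 0 / n.+1%:R].
Proof.
move=> /smooth_tower[r r0 tF] f0.
have B0 : Br r 0 by rewrite /= normr0.
have [H [tH HE H0]] := hadamard_tower r0 tF.
exists (H 0); split=> [|x|n].
- exact: (tower_smooth 0 (open_Br _) B0 tH).
- by have /= := HE x; rewrite f0 add0r.
- by rewrite (tower_iter _ (open_Br r) tH) ?H0.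
Qed.

Lemma smooth_at_sqrt {V : normedModType R} (p : V) (f : V -> R) : 0 < f p ->
  smooth_at p f -> smooth_at p (fun q => Num.sqrt (f q)).
Proof.
move=> fp sf; suff sq : smooth_at (f p) (@Num.sqrt R) by exact: smooth_at_comp sq sf.
exists [set y | 0 < y]; split=> // k.
elim: k => [|k IH] /=; first by move=> x _; exact: sqrt_continuous.
have oU : open [set y : R | 0 < y] by exact: open_gt.
have ds (x : R) : 0 < x -> differentiable Num.sqrt x.
  by move=> /is_derive1_sqrt[] /derivable1_diffP.
split=> // v; have cv : Ck k [set y : R | 0 < y] (fun=> v / 2 : R) by exact: Ck_cst.
apply: (Ck_ext oU _ (CkM oU cv (CkV oU _ IH))).
  by move=> x /= x0; rewrite (derive_scalar _ (ds _ x0)) derive_sqrt// invfM mulrA.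
by move=> x x0; rewrite gt_eqF// sqrtr_gt0.
Qed.

(** Injectivity near 0 comes from the mean value theorem, and smoothness of the inverse from g' = 1
    / f'(g). *)
Lemma smooth_inverse f : smooth_at 0 f -> f 0 = 0 -> 0 < 'D_1 f 0 ->
  exists g : R -> R, [/\ smooth_at 0 g, g 0 = 0,
    \forall x \near (0 : R), g (f x) = x & \forall y \near (0 : R), f (g y) = y].
Proof.
move=> sf f0 df0.
have [U [oU U0 cf]] := sf.
have nU : \forall x \near (0 : R), U x by exact: (open_nbhs_nbhs (conj oU U0)).
have sdf : smooth_at 0 (fun x => 'D_1 f x) by exact: smooth_at_derive sf.
have ndf : \forall x \near (0 : R), 0 < 'D_1 f x.
  exact: (cvgr_gt ('D_1 f 0) (smooth_at_continuous sdf)).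
have /nbhs_ballP[r /= r0 Hr] : \forall x \near (0 : R), U x /\ 0 < 'D_1 f x.
  by near=> x; split; near: x.
have {}Hr x : `|x| < r -> U x /\ 0 < 'D_1 f x.
  by move=> xr; apply: Hr; rewrite -ball_normE /= sub0r normrN.
have dfr (x : R) : `|x| < r -> is_derive x 1 f ('D_1 f x).
  move=> xr; apply/derivableP/derivable1_diffP.
  by have [+ _] := cf 1; apply; case: (Hr x xr).
have inj (x y : R) : `|x| < r -> `|y| < r -> f x = f y -> x = y.
  move=> xr yr fxy; apply/eqP; apply: contraT => nxy.
  have br z : Num.min x y <= z <= Num.max x y -> `|z| < r.
    move: xr yr; rewrite !ltr_norml => /andP[? ?] /andP[? ?].
    by case: (lerP x y) => ? /andP[? ?]; apply/andP; split; lra.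
  have cz z : Num.min x y <= z <= Num.max x y -> {for z, continuous f}.
    by move=> /br/dfr/is_derive_continuous.
  have dz z : Num.min x y < z < Num.max x y -> is_derive z 1 f ('D_1 f z).
    by move=> /andP[? ?]; apply/dfr/br; rewrite !ltW.
  have [c [/br/Hr[_ c0] _ /eqP]] := MVT_sym cz dz.
  rewrite fxy subrr eq_sym mulf_eq0 gt_eqF//= subr_eq0 eq_sym.
  by rewrite (negbTE nxy).
(* The preimage in the ball of radius [r]; the default 0 is taken off the image of that ball. *)
pose g y := xget 0 [set x | `|x| < r /\ f x = y].
have gf x : `|x| < r -> g (f x) = x.
  move=> xr; rewrite /g; case: xgetP => [z _ [zr zx]|/(_ x)]; first exact: inj.
  by case.
have g0 : g 0 = 0 by rewrite -[in LHS]f0 gf ?normr0.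
have nr x : `|x| < r -> {near x, cancel f g}.
  by move=> xr; apply: filterS (near_Br xr) => y; exact: gf.
have nc x : `|x| < r -> {near x, continuous f}.
  by move=> xr; apply: filterS (near_Br xr) => y yr; exact: is_derive_continuous (dfr y yr).
have r00 : `|0 : R| < r by rewrite normr0.
have cg : \forall y \near (0 : R), {for y, continuous g}.
  by have := near_can_continuous (nr 0 r00) (nc 0 r00); rewrite f0.
have fg : \forall y \near (0 : R), f (g y) = y.
  by have := near_continuous_can_sym (nc 0 r00) (nr 0 r00); rewrite f0.
have ngr : \forall y \near (0 : R), `|g y| < r.
  have cg0 : g y @[y --> (0 : R)] --> g 0 by exact: (nbhs_singleton cg).
  have : nbhs (g 0) (Br r) by rewrite g0; exact: near_Br.
  by move=> /cg0.
have : nbhs (0 : R) [set y | [/\ {for y, continuous g}, f (g y) = y & `|g y| < r]].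
  by near=> y; split; near: y.
rewrite nbhsE => -[V [oV V0 HV]].
have dg (y : R) : V y -> is_derive y 1 g ('D_1 f (g y))^-1.
  move=> /HV[_ fgy gr]; rewrite -[X in is_derive X]fgy.
  apply: (is_derive_inverse (nr _ gr) (nc _ gr) (dfr _ gr)).
  by rewrite gt_eqF//; case: (Hr _ gr).
exists g; split=> //; last by apply: filterS (near_Br r00) => x; exact: gf.
(* Bootstrapping: if g is of class C^k, so is g' = 1 / f'(g), hence g is of class C^(k+1). *)
exists V; split=> //; elim=> [|k IH]; first by move=> y /HV[].
have dgy y : V y -> differentiable g y.
  by move=> Vy; apply/derivable1_diffP; case: (dg y Vy).
split=> // v; have cv : Ck k V (fun=> v : R) by exact: Ck_cst.
have oB := open_Br r.
have cB : Ck k (Br r) (fun x => 'D_1 f x).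
  have [_ /(_ 1)] := cf k.+1; apply: Ck_sub => x /= xr.
  by case: (Hr _ xr).
have cBV : Ck k (Br r) (fun x => ('D_1 f x)^-1).
  by apply: CkV => // x /Hr[_ ?]; rewrite gt_eqF.
have gV y : V y -> Br r (g y) by move=> /HV[].
apply: (Ck_ext oV _ (CkM oV cv (Ck_comp oV gV cBV IH))) => y Vy /=.
by rewrite (derive_scalar _ (dgy _ Vy)) (is_deriveE (dg y Vy)).
Unshelve. all: by end_near. Qed.

End Whitney.

(** * Determinants and normal vectors *)

Section Determinants.
Context {K : comNzRingType}.

Lemma det3E (F : nat -> nat -> K) : \det (\matrix_(i < 3, j < 3) F i j) =
  F 0 0 * (F 1 1 * F 2 2 - F 1 2 * F 2 1)
  - F 0 1 * (F 1 0 * F 2 2 - F 1 2 * F 2 0)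
  + F 0 2 * (F 1 0 * F 2 1 - F 1 1 * F 2 0).
Proof.
rewrite (expand_det_row _ ord0) !big_ord_recl big_ord0 /cofactor.
rewrite !(expand_det_row _ ord0) !big_ord_recl !big_ord0 /cofactor !det_mx11.
by rewrite !mxE /= /bump /=; ring.
Qed.

(** The minor of the first three rows on the columns [j0], [j1], [j2]. *)
Definition det3 (F : nat -> nat -> K) (j0 j1 j2 : nat) :=
  F 0 j0 * (F 1 j1 * F 2 j2 - F 1 j2 * F 2 j1)
  - F 0 j1 * (F 1 j0 * F 2 j2 - F 1 j2 * F 2 j0)
  + F 0 j2 * (F 1 j0 * F 2 j1 - F 1 j1 * F 2 j0).

Lemma det4E (F : nat -> nat -> K) : \det (\matrix_(i < 4, j < 4) F i j) =
  - F 3 0 * det3 F 1 2 3 + F 3 1 * det3 F 0 2 3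
  - F 3 2 * det3 F 0 1 3 + F 3 3 * det3 F 0 1 2.
Proof.
rewrite (expand_det_row _ ord_max) !big_ord_recl big_ord0 /cofactor.
have E (k : 'I_4) : \det (row' ord_max (col' k (\matrix_(i < 4, j < 4) F i j))) =
    det3 F (bump k 0) (bump k 1) (bump k 2).
  apply: etrans (det3E (fun i j => F i (bump k j))); congr (\det _).
  by apply/matrixP => i j; rewrite !mxE /= /bump leqNgt ltn_ord.
by rewrite !E /det3 !mxE /= /bump /=; ring.
Qed.

End Determinants.

Section RowFunctions.
Context {R : realType} {V : normedModType R} {n : nat}.
Implicit Types (f : V -> 'rV[R]_n) (p v : V).

Lemma smooth_at_row p f :
  (forall i, smooth_at p (fun q => f q 0 i)) -> smooth_at p f.
Proof.
move=> sf; apply: (@smooth_at_ext _ _ _ _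
  (fun q => \sum_i f q 0 i *: (delta_mx 0 i : 'rV[R]_n))).
  by near=> q; rewrite -row_sum_delta.
by apply: smooth_at_sum => i; apply: smooth_atZl.
Unshelve. all: by end_near. Qed.

Lemma smooth_at_coord p f i : smooth_at p f -> smooth_at p (fun q => f q 0 i).
Proof.
have @L : {linear 'rV[R]_n -> R}.
  by exists (fun N : 'rV[R]_n => N 0 i); do 2![eexists]; do ?[constructor];
     rewrite ?mxE// => ? *; rewrite ?mxE//; move=> ?; rewrite !mxE.
by apply: (smooth_at_lin (L := L)); exact: coord_continuous.
Qed.

Lemma is_derive_row p v f (df : 'rV[R]_n) :
  (forall i, is_derive p v (fun q => f q 0 i) (df 0 i)) <-> is_derive p v f df.
Proof.
split=> [H|[H <-] i].
  have Df : derivable f p v.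
    by apply/derivable_mxP => i j; rewrite (ord1 i); case: (H j).
  apply: DeriveDef => //; rewrite derive_mx//.
  by apply/rowP => i; rewrite !mxE; case: (H i).
apply: DeriveDef; first by move/derivable_mxP: H; exact.
by rewrite derive_mx// mxE.
Qed.

Lemma derZ p v (k : V -> R) f dk (df : 'rV[R]_n) : is_derive p v k dk -> is_derive p v f df ->
  is_derive p v (fun q => k q *: f q) (dk *: f p + k p *: df).
Proof.
move=> Hk /is_derive_row Hf; apply/is_derive_row => i.
under eq_fun do rewrite mxE.
by apply: is_derive_eq (derM Hk (Hf i)) _; rewrite !mxE.
Qed.

End RowFunctions.

(** * Coordinates in R^4 and the Hodge dual *)

Section Coordinates.
Context {R : realType} (a : R).
Implicit Types (x y z w : 'rV[R]_4).

(** Indexing by natural numbers lets concrete coordinates be treated as atoms by [ring] and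
    [field]. *)
Definition cr x (k : nat) : R := x 0 (inord k).

Lemma crE x (i : 'I_4) : x 0 i = cr x i.
Proof. by rewrite /cr inord_val. Qed.

Lemma crD x y k : cr (x + y) k = cr x k + cr y k. Proof. by rewrite /cr mxE. Qed.
Lemma crN x k : cr (- x) k = - cr x k. Proof. by rewrite /cr mxE. Qed.
Lemma crZ (t : R) x k : cr (t *: x) k = t * cr x k. Proof. by rewrite /cr mxE. Qed.
Lemma cr0 k : cr 0 k = 0. Proof. by rewrite /cr mxE. Qed.

Lemma cr_row (s : nat -> R) k : (k < 4)%N -> cr (\row_(j < 4) s j) k = s k.
Proof. by move=> k4; rewrite /cr mxE inordK. Qed.

Lemma cr_inj x y : cr x 0 = cr y 0 -> cr x 1 = cr y 1 -> cr x 2 = cr y 2 ->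
  cr x 3 = cr y 3 -> x = y.
Proof.
move=> h0 h1 h2 h3; apply/rowP => i; rewrite !crE.
by case: i => [[|[|[|[|]]]]].
Qed.

Lemma cformE x w : cform a x w =
  cr x 0 * cr w 0 + a * (cr x 1 * cr w 1 + cr x 2 * cr w 2 + cr x 3 * cr w 3).
Proof.
by rewrite /cform /dot_sp !big_ord_recl big_ord0 !crE /= /bump /= addr0 !addrA.
Qed.

Lemma metricE x w : metric a x w = a^-1 * (cr x 0 * cr w 0) +
  (cr x 1 * cr w 1 + cr x 2 * cr w 2 + cr x 3 * cr w 3).
Proof.
by rewrite /metric /dot_sp !big_ord_recl big_ord0 !crE /= /bump /= addr0 !addrA.
Qed.

Definition minor3 x y z := det3 (fun i j => cr [:: x; y; z]`_i j).

Lemma det_gE x y z w : det_g x y z w =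
  - cr w 0 * minor3 x y z 1 2 3 + cr w 1 * minor3 x y z 0 2 3
  - cr w 2 * minor3 x y z 0 1 3 + cr w 3 * minor3 x y z 0 1 2.
Proof.
apply: etrans (det4E (fun i j => cr [:: x; y; z; w]`_i j)).
by rewrite /det_g; congr (\det _); apply/matrixP => i j; rewrite !mxE crE.
Qed.

Lemma det_gDr x y z w w' : det_g x y z (w + w') = det_g x y z w + det_g x y z w'.
Proof. by rewrite !det_gE !crD; ring. Qed.

Lemma det_gZr x y z (t : R) w : det_g x y z (t *: w) = t * det_g x y z w.
Proof. by rewrite !det_gE !crZ; ring. Qed.

Lemma det_g1 x y z : det_g x y z x = 0.
Proof. by rewrite det_gE /minor3 /det3 /=; ring. Qed.

Lemma det_g2 x y z : det_g x y z y = 0.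
Proof. by rewrite det_gE /minor3 /det3 /=; ring. Qed.

Lemma det_g3 x y z : det_g x y z z = 0.
Proof. by rewrite det_gE /minor3 /det3 /=; ring. Qed.

(* The Hodge dual of [x /\ y /\ z] with respect to the ambient form
   dx0^2 / a + dx1^2 + dx2^2 + dx3^2; it only involves the dual form, which makes
   sense for a = 0. *)
Definition hodge x y z : 'rV[R]_4 := \row_(j < 4)
  [:: - (a * minor3 x y z 1 2 3); minor3 x y z 0 2 3;
      - minor3 x y z 0 1 3; minor3 x y z 0 1 2]`_j.

Definition hodgeE x y z :=
  (cr_row (nth 0 [:: - (a * minor3 x y z 1 2 3); minor3 x y z 0 2 3;
      - minor3 x y z 0 1 3; minor3 x y z 0 1 2])).

Lemma hodge_tangent x y z : cform a x (hodge x y z) = 0.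
Proof. by rewrite cformE /hodge !hodgeE// /minor3 /det3 /=; ring. Qed.

(** For a nonzero, the factor a in the first entry of [hodge] cancels 1/a in the metric. For a = 0
    the tangency of w forces its first coordinate to vanish. *)
Lemma metric_hodge x y z w : 0 < cform a x x -> cform a x w = 0 ->
  metric a w (hodge x y z) = det_g x y z w.
Proof.
rewrite !cformE metricE det_gE /hodge !hodgeE//= => xx xw.
have [a0|a0] := eqVneq a 0; last by field.
move: xx xw; rewrite a0 !(mul0r, addr0) => xx xw.
have x0 : cr x 0 != 0 by apply: contraTneq xx => ->; rewrite mul0r ltxx.
have -> : cr w 0 = 0 by apply: (mulfI x0); rewrite xw mulr0.
ring.
Qed.

(** The dual is tangent at x, where the metric is positive definite. For a < 0, where the ambient
    form is indefinite, this is a reversed Cauchy-Schwarz argument. *)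
Lemma hodge_gt0 x y z w : 0 < cform a x x -> det_g x y z w != 0 ->
  0 < metric a (hodge x y z) (hodge x y z).
Proof.
move=> xx n0.
rewrite metric_hodge// ?hodge_tangent// det_gE /hodge !hodgeE//=.
have := det_g1 x y z.
move: n0 xx; rewrite !det_gE !cformE.
move: (minor3 _ _ _ 1%N 2%N 3%N) (minor3 _ _ _ 0%N 2%N 3%N)
  (minor3 _ _ _ 0%N 1%N 3%N) (minor3 _ _ _ 0%N 1%N 2%N) => m0 m1 m2 m3.
move: (cr x 0) (cr x 1) (cr x 2) (cr x 3) => x0 x1 x2 x3.
move=> n0 xx nx.
have -> : - - (a * m0) * m0 + m1 * m1 - - m2 * m2 + m3 * m3 =
  a * m0 ^+ 2 + (m1 ^+ 2 + m2 ^+ 2 + m3 ^+ 2) by ring.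
pose N := m1 ^+ 2 + m2 ^+ 2 + m3 ^+ 2.
pose F := x1 ^+ 2 + x2 ^+ 2 + x3 ^+ 2.
have N0 : 0 <= N by rewrite !addr_ge0 ?sqr_ge0.
have F0 : 0 <= F by rewrite !addr_ge0 ?sqr_ge0.
have Nz : N = 0 -> [/\ m1 = 0, m2 = 0 & m3 = 0].
  move=> NE; have h1 := sqr_ge0 m1; have h2 := sqr_ge0 m2; have h3 := sqr_ge0 m3.
  split; apply/eqP; rewrite -sqrf_eq0; apply/eqP; rewrite /N in NE; lra.
have xx' : 0 < x0 ^+ 2 + a * F by move: xx; rewrite /F; congr (_ < _); ring.
have nxE : x0 * m0 = x1 * m1 - x2 * m2 + x3 * m3 by lra.
(* If the last three minors vanish, then m0 does not, so x0 = 0; this forces a > 0, and the norm is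
   a m0^2. *)
have [Nle|Npos] := leP N 0.
  have [m10 m20 m30] : [/\ m1 = 0, m2 = 0 & m3 = 0].
    by apply: Nz; apply/eqP; rewrite eq_le Nle.
  have m00 : m0 != 0.
    apply: contra_neq n0 => ->; rewrite m10 m20 m30; ring.
  have x00 : x0 = 0.
    apply: (mulIf m00); rewrite nxE m10 m20 m30; ring.
  rewrite m10 m20 m30 expr0n /= !addr0.
  have apos : 0 < a.
    rewrite ltNge; apply/negP => a0; move: xx'.
    by rewrite x00 expr0n /= add0r ltNge mulr_le0_ge0.
  by rewrite mulr_gt0// exprn_even_gt0.
rewrite -/N; have [a0|a0] := leP 0 a.
  by rewrite ltr_wpDl// mulr_ge0// sqr_ge0.
have x0pos : 0 < x0 ^+ 2.
  by rewrite (lt_le_trans xx')// gerDl mulr_le0_ge0// ltW.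
rewrite -(pmulr_lgt0 _ x0pos) mulrDl.
(* With a < 0, this bounds x0^2 times the norm below by N (x0^2 + a F), which is positive since
   [cform a x x] is. *)
have CS : (x1 * m1 - x2 * m2 + x3 * m3) ^+ 2 <= N * F.
  rewrite -subr_ge0.
  have -> : N * F - (x1 * m1 - x2 * m2 + x3 * m3) ^+ 2 =
    (x1 * m2 + x2 * m1) ^+ 2 + (x1 * m3 - x3 * m1) ^+ 2 + (x2 * m3 + x3 * m2) ^+ 2.
    by rewrite /N /F; ring.
  by rewrite !addr_ge0 ?sqr_ge0.
have -> : a * m0 ^+ 2 * x0 ^+ 2 = a * (x1 * m1 - x2 * m2 + x3 * m3) ^+ 2.
  by rewrite -nxE; ring.
apply: (@lt_le_trans _ _ (N * (x0 ^+ 2 + a * F))); first by rewrite mulr_gt0.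
by rewrite mulrDr addrC lerD2r mulrCA ler_nM2l.
Qed.

End Coordinates.

(** * Singularities and genericity *)

Section Unitize.
Context {R : realType} (a : R).
Implicit Types (x w : 'rV[R]_4).

(** Projection along rays from the origin to the quadric, where [cform a x x] is positive. *)
Definition unitize x : 'rV[R]_4 := (Num.sqrt (cform a x x))^-1 *: x.

Lemma cformZl t x w : cform a (t *: x) w = t * cform a x w.
Proof. by rewrite !cformE !crZ; ring. Qed.

Lemma cformZr t x w : cform a x (t *: w) = t * cform a x w.
Proof. by rewrite !cformE !crZ; ring. Qed.

Lemma cformDr x w w' : cform a x (w + w') = cform a x w + cform a x w'.
Proof. by rewrite !cformE !crD; ring. Qed.

Lemma metricZr t x w : metric a x (t *: w) = t * metric a x w.
Proof. by rewrite !metricE !crZ; ring. Qed.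

Lemma metricZl t x w : metric a (t *: x) w = t * metric a x w.
Proof. by rewrite !metricE !crZ; ring. Qed.

Lemma tproj_tangent x w : cform a x x = 1 -> cform a x (tproj a x w) = 0.
Proof.
move=> xx; rewrite /tproj.
have E t : cform a x (w - t *: x) = cform a x w - t * cform a x x.
  by rewrite !cformE !(crD, crN, crZ); ring.
by rewrite E xx mulr1 subrr.
Qed.

Lemma unitize_space_form x : 0 < cform a x x -> (a <= 0 -> 0 < cr x 0) ->
  space_form a (unitize x).
Proof.
move=> xx x0; split=> [|a0]; rewrite /unitize.
  rewrite cformZl cformZr -{3}(sqr_sqrtr (ltW xx)).
  by field; rewrite gt_eqF// sqrtr_gt0.
by rewrite mxE mulr_gt0 ?invr_gt0 ?sqrtr_gt0// (crE x 0) x0.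
Qed.

Lemma unitizeZ t x : 0 < t -> cform a x x = 1 -> unitize (t *: x) = x.
Proof.
move=> t0 xx; rewrite /unitize cformZl cformZr xx mulr1 -expr2 sqrtr_sqr.
by rewrite gtr0_norm// scalerA mulVf ?scale1r// gt_eqF.
Qed.

Context {V : normedModType R}.
Implicit Types (p : V) (P Q S : V -> 'rV[R]_4).

Lemma smooth_at_cr p P k : smooth_at p P -> smooth_at p (fun q => cr (P q) k).
Proof. by move=> sP; exact: smooth_at_coord. Qed.

Lemma smooth_at_cform p P Q : smooth_at p P -> smooth_at p Q ->
  smooth_at p (fun q => cform a (P q) (Q q)).
Proof.
move=> sP sQ; under eq_fun do rewrite cformE.
have sp k := smooth_at_cr k sP; have sq k := smooth_at_cr k sQ.
apply: smooth_atD; first exact: smooth_atM.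
apply: smooth_atM; first exact: smooth_at_cst.
by do 2?[apply: smooth_atD]; exact: smooth_atM.
Qed.

Lemma smooth_at_metric p P Q : smooth_at p P -> smooth_at p Q ->
  smooth_at p (fun q => metric a (P q) (Q q)).
Proof.
move=> sP sQ; under eq_fun do rewrite metricE.
have sp k := smooth_at_cr k sP; have sq k := smooth_at_cr k sQ.
apply: smooth_atD.
  by apply: smooth_atM; [exact: smooth_at_cst | exact: smooth_atM].
by do 2?[apply: smooth_atD]; exact: smooth_atM.
Qed.

Lemma smooth_at_scale p (k : V -> R) P : smooth_at p k -> smooth_at p P ->
  smooth_at p (fun q => k q *: P q).
Proof.
move=> sk sP; apply: smooth_at_row => i; under eq_fun do rewrite mxE.
by apply: smooth_atM => //; exact: smooth_at_coord.
Qed.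

Lemma smooth_at_unitizer p P : smooth_at p P -> 0 < cform a (P p) (P p) ->
  smooth_at p (fun q => (Num.sqrt (cform a (P q) (P q)))^-1).
Proof.
move=> sP PP; apply: smooth_atV; first by rewrite gt_eqF// sqrtr_gt0.
by apply: smooth_at_sqrt => //; exact: smooth_at_cform.
Qed.

Lemma smooth_at_unitize p P : smooth_at p P -> 0 < cform a (P p) (P p) ->
  smooth_at p (fun q => unitize (P q)).
Proof. by move=> sP PP; apply: smooth_at_scale => //; exact: smooth_at_unitizer. Qed.

Lemma smooth_at_minor3 p P Q S j0 j1 j2 :
  smooth_at p P -> smooth_at p Q -> smooth_at p S ->
  smooth_at p (fun q => minor3 (P q) (Q q) (S q) j0 j1 j2).
Proof.
move=> sP sQ sS; rewrite /minor3 /det3 /=.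
have sp k := smooth_at_cr k sP; have sq k := smooth_at_cr k sQ.
have ss k := smooth_at_cr k sS.
by apply: smooth_atD; [apply: smooth_atB|]; apply: smooth_atM => //;
  apply: smooth_atB; exact: smooth_atM.
Qed.

Lemma smooth_at_hodge p P Q S :
  smooth_at p P -> smooth_at p Q -> smooth_at p S ->
  smooth_at p (fun q => hodge a (P q) (Q q) (S q)).
Proof.
move=> sP sQ sS; apply: smooth_at_row; rewrite /hodge.
have sm j0 j1 j2 := smooth_at_minor3 j0 j1 j2 sP sQ sS.
case=> [[|[|[|[|//]]]] i4]; under eq_fun do rewrite mxE /=.
- by apply/smooth_atN/smooth_atM => //; exact: smooth_at_cst.
- by [].
- exact: smooth_atN.
- by [].
Qed.

End Unitize.

Section Projections.
Context {R : realType}.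
Implicit Types (p w : R * R).

Lemma smooth_at_fst p : smooth_at p (fun q : R * R => q.1).
Proof.
apply: (smooth_at_lin (L := fst)) (smooth_at_id _) => x; exact: cvg_fst.
Qed.

Lemma smooth_at_snd p : smooth_at p (fun q : R * R => q.2).
Proof.
apply: (smooth_at_lin (L := snd)) (smooth_at_id _) => x; exact: cvg_snd.
Qed.

Lemma is_derive_fst p w : is_derive p w (fun q : R * R => q.1) w.1.
Proof.
have sd := smooth_at_diff (smooth_at_fst p).
apply: DeriveDef; first exact: diff_derivable.
by rewrite deriveE// (diff_lin (f := fst))// => x; exact: cvg_fst.
Qed.

Lemma is_derive_snd p w : is_derive p w (fun q : R * R => q.2) w.2.
Proof.
have sd := smooth_at_diff (smooth_at_snd p).
apply: DeriveDef; first exact: diff_derivable.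
by rewrite deriveE// (diff_lin (f := snd))// => x; exact: cvg_snd.
Qed.

End Projections.

(** * Projections of maps P with P_u = c P_v + v X *)

Section Front.
Context {R : realType} (a : R).
Variables (P X : R * R -> 'rV[R]_4) (c : R * R -> R).
Hypotheses (sP : smooth_at 0 P) (sX : smooth_at 0 X) (sc : smooth_at 0 c).
Hypotheses (c0 : c 0 = 0) (P0 : space_form a (P 0)).
Hypothesis relP :
  \forall p \near (0 : R * R), 'D_e_u P p = c p *: 'D_e_v P p + p.2 *: X p.
Hypothesis nondeg :
  det_g (P 0) (X 0) ('D_e_v P 0) ('D_e_v (fun p => 'D_e_v P p) 0) != 0.

Let f p := unitize a (P p).
Let l p := (Num.sqrt (cform a (P p) (P p)))^-1.
(** Dual to the hyperplane spanned by P, X and P_v, which contains both partial derivatives of f at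
    every point near 0, singular or not. *)
Let h p := hodge a (P p) (X p) ('D_e_v P p).
Let nu p := (Num.sqrt (metric a (h p) (h p)))^-1 *: h p.

Let PP0 : 0 < cform a (P 0) (P 0). Proof. by case: P0 => ->. Qed.
Let sPv : smooth_at 0 (fun p => 'D_e_v P p). Proof. exact: smooth_at_derive. Qed.
Let sf : smooth_at 0 f. Proof. exact: smooth_at_unitize. Qed.
Let sl : smooth_at 0 l. Proof. exact: smooth_at_unitizer. Qed.
Let sh : smooth_at 0 h. Proof. exact: smooth_at_hodge. Qed.
Let l0 : l 0 = 1. Proof. by rewrite /l; case: P0 => -> _; rewrite sqrtr1 invr1. Qed.

Let hh0 : 0 < metric a (h 0) (h 0). Proof. exact: hodge_gt0 nondeg. Qed.

Let near_PP : \forall p \near (0 : R * R), 0 < cform a (P p) (P p).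
Proof. exact: (cvgr_gt _ (smooth_at_continuous (smooth_at_cform a sP sP))). Qed.

Let near_hh : \forall p \near (0 : R * R), 0 < metric a (h p) (h p).
Proof. exact: (cvgr_gt _ (smooth_at_continuous (smooth_at_metric a sh sh))). Qed.

Let near_f : \forall p \near (0 : R * R), space_form a (f p).
Proof.
have n0 : \forall p \near (0 : R * R), a <= 0 -> 0 < cr (P p) 0.
  have [_] := P0; case: (a <= 0) => [/(_ isT)|_]; last by near=> p.
  rewrite (crE (P 0) 0) => cP.
  by apply: filterS (cvgr_gt _ (smooth_at_continuous (smooth_at_cr 0 sP)) _ cP).
near=> p; apply: unitize_space_form; near: p; first exact: near_PP.
exact: n0.
Unshelve. all: by end_near. Qed.

Let df w p : smooth_at p P -> 0 < cform a (P p) (P p) ->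
  'D_w f p = 'D_w l p *: P p + l p *: 'D_w P p.
Proof.
move=> sPp PPp; apply: is_deriveE (derZ _ _).
  by apply: smooth_at_derivable; exact: smooth_at_unitizer.
exact: smooth_at_derivable.
Qed.

(** Differentiation of [cform a (f q) (f q) = 1]: derivatives of f are tangent. *)
Let dcform w p : smooth_at p f -> (\forall q \near p, space_form a (f q)) ->
  cform a (f p) ('D_w f p) = 0.
Proof.
move=> sfp nf.
have Hc k : is_derive p w (fun q => cr (f q) k) (cr ('D_w f p) k).
  by have /is_derive_row := smooth_at_derivable w sfp; exact.
have E : is_derive p w (fun q => cform a (f q) (f q)) (2 * cform a (f p) ('D_w f p)).
  under eq_fun do rewrite cformE.
  have Hs k : is_derive p w (fun q => cr (f q) k * cr (f q) k)
      (cr ('D_w f p) k * cr (f p) k + cr (f p) k * cr ('D_w f p) k).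
    exact: derM.
  apply: is_derive_eq (derD (Hs 0%N) (derM (derC _ _ a)
    (derD (derD (Hs 1%N) (Hs 2)) (Hs 3)))) _.
  by rewrite cformE; ring.
have C : is_derive p w (fun q => cform a (f q) (f q)) 0.
  apply: near_eq_is_derive (derC p w (1 : R)).
  by apply: filterS nf => q [].
have : 2 * cform a (f p) ('D_w f p) = 0.
  by rewrite -(is_deriveE E) (is_deriveE C).
by move/eqP; rewrite mulf_eq0 pnatr_eq0 /= => /eqP.
Qed.

Let good p := [/\ smooth_at p P, smooth_at p f, 0 < cform a (P p) (P p),
  0 < metric a (h p) (h p) &
  [/\ \forall q \near p, space_form a (f q) &
  'D_e_u P p = c p *: 'D_e_v P p + p.2 *: X p]].

Let near_good : \forall p \near (0 : R * R), good p.
Proof.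
have n1 := smooth_at_near sP; have n2 := smooth_at_near sf.
have n3 := near_join near_f.
by near=> p; split; [| | | |split]; near: p.
Unshelve. all: by end_near. Qed.

Let lpos p : good p -> 0 < l p.
Proof. by case=> _ _ PP _ _; rewrite invr_gt0 sqrtr_gt0. Qed.

Let tangentP w p : good p -> cform a (P p) ('D_w f p) = 0.
Proof.
move=> gp; have lp := lpos gp; case: gp => _ sfp _ _ [nf _].
have := dcform w sfp nf; rewrite /f /unitize -/(l p) cformZl => /eqP.
by rewrite mulf_eq0 gt_eqF//= => /eqP.
Qed.

Let duf p : good p -> 'D_e_u f p = 'D_e_u l p *: P p + l p *: (c p *: 'D_e_v P p + p.2 *: X p).
Proof. by case=> sPp _ PPp _ [_ <-]; exact: df. Qed.

Let dvf p : good p -> 'D_e_v f p = 'D_e_v l p *: P p + l p *: 'D_e_v P p.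
Proof. by case=> sPp _ PPp _ _; exact: df. Qed.

Let det_h p : good p -> det_g (P p) (X p) ('D_e_v P p) (h p) = metric a (h p) (h p).
Proof. by case=> _ _ PPp _ _; rewrite metric_hodge// hodge_tangent. Qed.

(** Up to a positive factor, the product of a derivative of f with [nu] is its determinant with P,
    X, P_v; the derivatives of f are combinations of these three vectors. *)
Let front_normal : unit_normal_field a f nu.
Proof.
split.
  apply: smooth_at_scale => //; apply: smooth_atV; first by rewrite gt_eqF// sqrtr_gt0.
  by apply: smooth_at_sqrt => //; exact: smooth_at_metric.
apply: filterS near_good => p gp; have lp := lpos gp.
have [_ _ PPp hp [_ _]] := gp.
have D w : metric a ('D_w f p) (nu p) =
    (Num.sqrt (metric a (h p) (h p)))^-1 * det_g (P p) (X p) ('D_e_v P p) ('D_w f p).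
  by rewrite /nu metricZr; congr (_ * _); apply: metric_hodge => //; exact: tangentP.
split.
- rewrite /tangent /= /nu cformZr /f cformZl hodge_tangent; ring.
- rewrite /nu metricZr metricZl -{3}(sqr_sqrtr (ltW hp)).
  by field; rewrite gt_eqF// sqrtr_gt0.
- by rewrite D (duf gp) !(det_gDr, det_gZr, det_g1, det_g2, det_g3); ring.
- by rewrite D (dvf gp) !(det_gDr, det_gZr, det_g1, det_g2, det_g3); ring.
Qed.

Let g0 : good 0. Proof. exact: nbhs_singleton near_good. Qed.

Let f0E : f 0 = P 0.
Proof. by rewrite /f /unitize -/(l 0) l0 scale1r. Qed.

(** Modulo P and P_v the mixed derivative at the origin is X: c vanishes there, and v X has
    v-derivative X. *)
Let dvuf : exists t1 t2 : R,
  'D_e_v (fun p => 'D_e_u f p) 0 = t1 *: P 0 + t2 *: 'D_e_v P 0 + X 0.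
Proof.
pose lu p := 'D_e_u l p.
have slu : smooth_at 0 lu by exact: smooth_at_derive.
have Hlu := smooth_at_derivable e_v slu.
have Hl := smooth_at_derivable e_v sl.
have HP := smooth_at_derivable e_v sP.
have HPv := smooth_at_derivable e_v sPv.
have HX := smooth_at_derivable e_v sX.
have Hc := smooth_at_derivable e_v sc.
have H2 := is_derive_snd (0 : R * R) e_v.
exists ('D_e_v lu 0), (lu 0 + 'D_e_v c 0).
have E := derD (derZ Hlu HP) (derZ Hl (derD (derZ Hc HPv) (derZ H2 HX))).
have nE : \forall p \near (0 : R * R),
    lu p *: P p + l p *: (c p *: 'D_e_v P p + p.2 *: X p) = 'D_e_u f p.
  by apply: filterS near_good => p gp; rewrite (duf gp).
rewrite (is_deriveE (near_eq_is_derive nE E)) c0 l0 /=.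
move: ('D_e_v P 0) (X 0) (P 0) ('D_e_v _ 0) ('D_e_v X 0) => pv x p pvv xv.
by apply: cr_inj; rewrite !(crD, crZ); ring.
Qed.

Let dvvf : exists t1 t2 : R, 'D_e_v (fun p => 'D_e_v f p) 0 =
  t1 *: P 0 + t2 *: 'D_e_v P 0 + 'D_e_v (fun p => 'D_e_v P p) 0.
Proof.
pose lv p := 'D_e_v l p.
have slv : smooth_at 0 lv by exact: smooth_at_derive.
have Hlv := smooth_at_derivable e_v slv.
have Hl := smooth_at_derivable e_v sl.
have HP := smooth_at_derivable e_v sP.
have HPv := smooth_at_derivable e_v sPv.
exists ('D_e_v lv 0), (lv 0 + 'D_e_v l 0).
have E := derD (derZ Hlv HP) (derZ Hl HPv).
have nE : \forall p \near (0 : R * R),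
    lv p *: P p + l p *: 'D_e_v P p = 'D_e_v f p.
  by apply: filterS near_good => p gp; rewrite (dvf gp).
by rewrite (is_deriveE (near_eq_is_derive nE E)) l0 scale1r scalerDl !addrA.
Qed.

(** Multiples of P and P_v drop out of the determinant; what remains is a positive multiple of
    det(P, X, P_v, h), the squared norm of [h]. *)
Let front_positive : positive_normal a f nu.
Proof.
have [t1 [t2 E]] := dvuf.
have hp := hh0; have k0 : 0 < (Num.sqrt (metric a (h 0) (h 0)))^-1.
  by rewrite invr_gt0 sqrtr_gt0.
rewrite /positive_normal /cov /tproj E f0E (dvf g0) l0 /nu.
move: k0; set k := (Num.sqrt _)^-1 => k0.
move: (cform _ _ _) => t3; move: ('D_e_v l 0) => t4.
rewrite (_ : det_g _ _ _ _ = k * det_g (P 0) (X 0) ('D_e_v P 0) (h 0)).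
  by rewrite (det_h g0) mulr_gt0.
by rewrite !det_gE /minor3 /det3 /= !(crD, crN, crZ); ring.
Qed.

(** The second v-derivative of f is P_vv modulo P and P_v, so its product with [nu] is a positive
    multiple of the determinant in [nondeg]. *)
Let front_sigma : sigmaS a f nu != 0.
Proof.
have [t1 [t2 E]] := dvvf.
have hp := hh0; have k0 : 0 < (Num.sqrt (metric a (h 0) (h 0)))^-1.
  by rewrite invr_gt0 sqrtr_gt0.
rewrite /sigmaS sgr_eq0 /cov f0E /nu metricZr.
apply: mulf_neq0; first by rewrite gt_eqF.
rewrite metric_hodge//; last first.
  by apply: tproj_tangent; case: P0.
rewrite E /tproj; move: (cform _ _ _) => t3; rewrite (_ : det_g _ _ _ _ =
  det_g (P 0) (X 0) ('D_e_v P 0) ('D_e_v (fun p => 'D_e_v P p) 0)).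
  exact: nondeg.
by rewrite -scaleNr !(det_gDr, det_gZr, det_g1, det_g3); ring.
Qed.

Lemma free2 (x y : 'rV[R]_4) : free [:: x; y] = (x \notin <[y]>%VS) && (y != 0).
Proof. by rewrite free_cons span_seq1 seq1_free. Qed.

(** Modulo P, f_u is l (c P_v + v X) and f_v is l P_v, with P, X, P_v independent; hence f_u and f_v
    are independent for nonzero v. *)
Let front_admissible : admissible f.
Proof.
apply: filterS near_good => p gp; have lp := lpos gp.
have dp : 0 < det_g (P p) (X p) ('D_e_v P p) (h p) by rewrite (det_h gp); case: gp.
rewrite /singular_point free2; split=> [|p2].
  apply: contraNeq => p2; apply/andP; split.
    apply/negP => /vlineP[k]; rewrite (duf gp) (dvf gp) => E.
    have : det_g (P p) ('D_e_u l p *: P p + l p *: (c p *: 'D_e_v P p + p.2 *: X p))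
        ('D_e_v P p) (h p) = 0.
      by rewrite E !det_gE /minor3 /det3 /= !(crD, crZ); ring.
    apply/eqP; rewrite (_ : det_g _ _ _ _ =
        l p * p.2 * det_g (P p) (X p) ('D_e_v P p) (h p)).
      by rewrite !mulf_neq0// gt_eqF.
    by rewrite !det_gE /minor3 /det3 /= !(crD, crZ); ring.
  rewrite (dvf gp); apply/eqP => E.
  have : det_g (P p) (X p) ('D_e_v l p *: P p + l p *: 'D_e_v P p) (h p) = 0.
    by rewrite E !det_gE /minor3 /det3 /= !cr0; ring.
  apply/eqP; rewrite (_ : det_g _ _ _ _ =
      l p * det_g (P p) (X p) ('D_e_v P p) (h p)).
    by rewrite !mulf_neq0// gt_eqF.
  by rewrite !det_gE /minor3 /det3 /= !(crD, crZ); ring.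
rewrite negb_and negbK; apply/orP; left; apply/vlineP; exists (c p).
rewrite (duf gp) (dvf gp) p2 scale0r addr0.
(* Both sides differ by a multiple of [P p], but are tangent at [P p]. *)
have [_ _ PPp _ _] := gp.
have : cform a (P p) ('D_e_u f p) - c p * cform a (P p) ('D_e_v f p) = 0.
  have h1 := tangentP e_u gp; have h2 := tangentP e_v gp.
  by apply/eqP; rewrite subr_eq0; apply/eqP; rewrite [LHS]h1 [X in _ * X]h2 mulr0.
rewrite (duf gp) (dvf gp) p2 scale0r addr0.
rewrite !(cformDr, cformZr).
move: (cform a (P p) ('D_e_v P p)) ('D_e_u l p) ('D_e_v l p) => k lu lv.
move: (cform a (P p) (P p)) (l p) (c p) PPp {lp dp} => q t s q0 E.
have {}E : (lu - s * lv) * q = 0 by rewrite -E; ring.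
move/eqP: E; rewrite mulf_eq0 (gt_eqF q0) orbF subr_eq0 => /eqP ->.
by rewrite scalerDr !scalerA (mulrC t).
Qed.

Lemma front_generic : [/\ \forall p \near (0 : R * R), space_form a (unitize a (P p)),
  smooth_at 0 (fun p => unitize a (P p)), admissible (fun p => unitize a (P p)) &
  generic a (fun p => unitize a (P p))].
Proof. by split=> //; exists nu; split. Qed.

End Front.

(** * Normal form of a cusp *)

Section ConstantMatrix.
Context {R : realType} {V : normedModType R} {m n : nat} (N : 'M[R]_(m, n)).
Implicit Types (f : V -> 'rV[R]_m) (p v : V).

Lemma smooth_at_mulmx p f : smooth_at p f -> smooth_at p (fun q => f q *m N).
Proof.
move=> sf; apply: smooth_at_row => j; under eq_fun do rewrite mxE.
apply: smooth_at_sum => i; apply: smooth_atM; last exact: smooth_at_cst.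
exact: smooth_at_coord.
Qed.

Lemma is_derive_mulmx p v f (df : 'rV[R]_m) :
  is_derive p v f df -> is_derive p v (fun q => f q *m N) (df *m N).
Proof.
move=> /is_derive_row Hf; apply/is_derive_row => j.
have -> : (fun q => (f q *m N) 0 j) = \sum_i (fun q => f q 0 i * N i j).
  by apply/funext => q; rewrite mxE fct_sumE.
rewrite mxE; apply: is_derive_sum => i.
by apply: is_derive_eq (derM (Hf i) (derC _ _ (N i j))) _; rewrite mulr0 addr0.
Qed.

End ConstantMatrix.

Lemma basis_extension {K : fieldType} (x y z : 'rV[K]_4) : free [:: x; y; z] ->
  exists w, \matrix_(i < 4) [:: x; y; z; w]`_i \in unitmx.
Proof.
move=> fX.
have /subvPn[w _ wX] : ~~ ({: 'rV[K]_4} <= <<[:: x; y; z]>>)%VS.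
  apply/negP => /dimvS; rewrite dimvf => /leq_trans/(_ (dim_span _)).
  by rewrite /dim /= mul1n.
exists w.
have /freeP fT : free (in_tuple [:: x; y; z; w]).
  have pE : perm_eq (rcons [:: x; y; z] w) (w :: [:: x; y; z]).
    by rewrite perm_rcons.
  by rewrite /= (perm_free pE) free_cons wX.
rewrite -row_free_unit; apply: inj_row_free => v.
rewrite mulmx_sum_row => E; apply/rowP => i; rewrite mxE; apply: fT.
by rewrite -[RHS]E; apply: eq_bigr => j _; rewrite rowK.
Qed.

Section Cusp.
Context {R : realType} (a : R).
Implicit Types (g : R -> R) (x w : 'rV[R]_4).

Let D (g : R -> R) : R -> R := fun u => 'D_1 g u.

Lemma hadamard2 g : smooth_at 0 g -> g 0 = 0 -> D g 0 = 0 ->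
  exists m, [/\ smooth_at 0 m, forall u, g u = u ^+ 2 * m u,
    m 0 = D (D g) 0 / 2 & D m 0 = D (D (D g)) 0 / 6].
Proof.
move=> sg g0 dg0.
have [m1 [sm1 E1 H1]] := hadamard sg g0.
have m10 : m1 0 = 0 by have /= := H1 0%N; rewrite [X in X / _]dg0 mul0r.
have [m [sm E H]] := hadamard sm1 m10.
exists m; split=> //.
- by move=> u; rewrite E1 E; ring.
- have /= -> := H 0%N; have /= -> := H1 1%N; rewrite divr1; exact.
- apply: (etrans (H 1%N)); have /= h := H1 2; rewrite /= h.
  by rewrite -mulrA -invfM -natrM.
Qed.

Lemma hadamard3 g : smooth_at 0 g -> g 0 = 0 -> D g 0 = 0 -> D (D g) 0 = 0 ->
  exists m, [/\ smooth_at 0 m, forall u, g u = u ^+ 3 * m u &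
    m 0 = D (D (D g)) 0 / 6].
Proof.
move=> sg g0 dg0 ddg0.
have [m2 [sm2 E2 m20 dm20]] := hadamard2 sg g0 dg0.
rewrite ddg0 mul0r in m20.
have [m [sm E H]] := hadamard sm2 m20.
exists m; split=> //; first by move=> u; rewrite E2 E; ring.
by have /= -> := H 0%N; rewrite divr1.
Qed.

(** At the cusp, covariant and ordinary derivatives differ by multiples of [gamma 0]. That vector is
    independent of the two covariant ones, which are tangent, so the three extend to a basis, the
    rows of [M]. *)
Lemma cusp_basis (gamma : R -> 'rV[R]_4) : space_cusp a gamma ->
  exists M : 'M[R]_4, [/\ M \in unitmx, row 0 M = gamma 0,
    'D_1 gamma 0 = 0,
    exists t, 'D_1 (fun u => 'D_1 gamma u) 0 = row 1 M + t *: gamma 0 &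
    exists t, 'D_1 (fun u => 'D_1 (fun z => 'D_1 gamma z) u) 0 =
      row 2 M + t *: gamma 0].
Proof.
case=> sg /nbhs_singleton[gg _] /nbhs_singleton[_ /(_ erefl) g10].
pose g2 u := 'D_1 (fun z => 'D_1 gamma z) u.
have sg1 : smooth_at 0 (fun z => 'D_1 gamma z) by exact: smooth_at_derive.
have sg2 : smooth_at 0 g2 by exact: smooth_at_derive.
have sq : smooth_at 0 (fun u => cform a (gamma u) (g2 u)).
  exact: smooth_at_cform.
pose b1 := cov a gamma 1 ('D_1 gamma) 0.
pose b2 := cov a gamma 1 (cov a gamma 1 ('D_1 gamma)) 0.
move=> fb; have {}fb : free [:: b1; b2] by exact: fb.
have b1E : g2 0 = b1 + cform a (gamma 0) (g2 0) *: gamma 0 by rewrite subrK.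
have b1t : cform a (gamma 0) b1 = 0 by exact: tproj_tangent.
have b2t : cform a (gamma 0) b2 = 0 by exact: tproj_tangent.
have [t b2E] : exists t, 'D_1 g2 0 = b2 + t *: gamma 0.
  have Hg := smooth_at_derivable (1 : R) sg; rewrite g10 in Hg.
  (* As gamma'(0) = 0, differentiating the normal part of the first covariant derivative yields only
     a multiple of [gamma 0]. *)
  have E := derB (smooth_at_derivable (1 : R) sg2) (derZ (smooth_at_derivable (1 : R) sq) Hg).
  pose y := 'D_1 (cov a gamma 1 ('D_1 gamma)) 0.
  have yE : y = 'D_1 g2 0 - 'D_1 (fun u => cform a (gamma u) (g2 u)) 0 *: gamma 0.
    by rewrite /y (is_deriveE E) scaler0 addr0.
  exists ('D_1 (fun u => cform a (gamma u) (g2 u)) 0 + cform a (gamma 0) y).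
  rewrite (_ : b2 = y - cform a (gamma 0) y *: gamma 0)//.
  move: (cform a (gamma 0) y) => k; rewrite yE.
  by apply/rowP => i; rewrite !mxE; ring.
clearbody b1 b2.
have fp : free [:: gamma 0; b1; b2].
  rewrite free_cons fb andbT; apply/negP.
  rewrite span_cons span_seq1 => /memv_addP[_ /vlineP[k1 ->] [_ /vlineP[k2 ->]]] E.
  have : cform a (gamma 0) (gamma 0) = 0.
    by rewrite [X in cform _ _ X]E cformDr !cformZr b1t b2t; ring.
  by rewrite gg => /eqP; rewrite oner_eq0.
have [w Mu] := basis_extension fp.
exists (\matrix_(i < 4) [:: gamma 0; b1; b2; w]`_i).
split=> //; try (by rewrite rowK).
- by exists (cform a (gamma 0) (g2 0)); rewrite rowK.
- by exists t; rewrite rowK.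
Qed.

Definition nrow (x0 x1 x2 x3 : R) : 'rV[R]_4 := \row_(j < 4) [:: x0; x1; x2; x3]`_j.

Lemma cr_nrow (x0 x1 x2 x3 : R) k : (k < 4)%N -> cr (nrow x0 x1 x2 x3) k = [:: x0; x1; x2; x3]`_k.
Proof. exact: (cr_row (nth 0 [:: x0; x1; x2; x3])). Qed.

Lemma cr_row1 (i : 'I_4) k : (k < 4)%N -> cr (row i (1%:M : 'M[R]_4)) k = (i == k :> nat)%:R.
Proof. by move=> k4; rewrite /cr !mxE -val_eqE /= inordK. Qed.

Lemma derive_cr_mulmx (N : 'M[R]_4) (f : R -> 'rV[R]_4) p k : smooth_at p f ->
  'D_1 (fun u => cr (f u *m N) k) p = cr ('D_1 f p *m N) k.
Proof.
move=> sf; have := is_derive_mulmx N (smooth_at_derivable (1 : R) sf).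
by move=> /is_derive_row/(_ (inord k))/is_deriveE.
Qed.

(** [cusp_basis] gives the derivatives at 0 of the coordinates in the basis [M]. Coordinates 1 and 3
    vanish to order two and coordinate 2 to order three, so Hadamard's lemma extracts u^2 and u^3;
    the values 1/2 and 1/6 are Taylor coefficients. *)
Lemma cusp_coordinates (gamma : R -> 'rV[R]_4) : space_cusp a gamma ->
  exists (M N : 'M[R]_4) (y0 m1 m2 m3 : R -> R),
  [/\ M *m N = 1%:M, N *m M = 1%:M, row 0 M = gamma 0,
     [/\ smooth_at 0 y0, smooth_at 0 m1, smooth_at 0 m2 & smooth_at 0 m3] &
     [/\ y0 0 = 1, m1 0 = 2^-1, m2 0 = 6^-1 &
      forall u, gamma u = nrow (y0 u) (u ^+ 2 * m1 u) (u ^+ 3 * m2 u)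
        (u ^+ 2 * m3 u) *m M]].
Proof.
move=> cg; have [sg _ _ _] := cg.
have [M [Mu M0 g1 [t2 g2] [t3 g3]]] := cusp_basis cg.
pose N := invmx M; pose y k u := cr (gamma u *m N) k.
have MN : M *m N = 1%:M by exact: mulmxV.
have sy k : smooth_at 0 (y k) by exact/smooth_at_cr/smooth_at_mulmx.
have sg1 : smooth_at 0 (fun u => 'D_1 gamma u) by exact: smooth_at_derive.
have sg2 : smooth_at 0 (fun u => 'D_1 (fun z => 'D_1 gamma z) u).
  exact: smooth_at_derive.
have rowMN i : row i M *m N = row i 1%:M by rewrite -row_mul MN.
have zk k : (0 < k)%N -> (0 : 'I_4) != k :> nat by rewrite eq_sym lt0n.
have y00 k : (k < 4)%N -> y k 0 = (0 == k)%:R.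
  by move=> k4; rewrite /y -M0 rowMN cr_row1.
have dy k : \forall u \near (0 : R), D (y k) u = cr ('D_1 gamma u *m N) k.
  by apply: filterS (smooth_at_near sg) => u; exact: derive_cr_mulmx.
have dy0 k : D (y k) 0 = 0.
  by rewrite (nbhs_singleton (dy k)) g1 mul0mx cr0.
have ddy k : \forall u \near (0 : R), D (D (y k)) u =
    cr ('D_1 (fun z => 'D_1 gamma z) u *m N) k.
  have n1 := near_join (dy k); have n2 := smooth_at_near sg1.
  near=> u; rewrite -derive_cr_mulmx; last by near: u.
  by apply: near_eq_derive; near: u.
have ddy0 k : (0 < k < 4)%N -> D (D (y k)) 0 = (1 == k)%:R.
  move=> /andP[k0 k4]; rewrite (nbhs_singleton (ddy k)) g2 mulmxDl crD -scalemxAl.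
  by rewrite crZ -M0 !rowMN !cr_row1// (negbTE (zk k k0)) mulr0 addr0.
have dddy0 k : (0 < k < 4)%N -> D (D (D (y k))) 0 = (2 == k)%:R.
  move=> /andP[k0 k4]; rewrite [LHS](near_eq_derive (1 : R) (ddy k)).
  rewrite derive_cr_mulmx// g3 mulmxDl crD -scalemxAl.
  by rewrite crZ -M0 !rowMN !cr_row1// (negbTE (zk k k0)) mulr0 addr0.
have [m1 [sm1 E1 m10 _]] := hadamard2 (sy 1%N) (y00 1%N isT) (dy0 1%N).
have [m2 [sm2 E2 m20]] := hadamard3 (sy 2%N) (y00 2%N isT) (dy0 2%N) (ddy0 2%N isT).
have [m3 [sm3 E3 _ _]] := hadamard2 (sy 3%N) (y00 3%N isT) (dy0 3%N).
exists M, N, (y 0%N), m1, m2, m3; split=> //; first exact: mulVmx.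
split.
- exact: y00.
- by rewrite m10 ddy0//= div1r.
- by rewrite m20 dddy0//= div1r.
move=> u; rewrite -E1 -E2 -E3 -[LHS]mulmx1 -(mulVmx Mu) mulmxA; congr (_ *m M).
by apply: cr_inj; rewrite cr_nrow.
Unshelve. all: by end_near. Qed.

Lemma cusp_normal_form (gamma : R -> 'rV[R]_4) : space_cusp a gamma ->
  exists (M N : 'M[R]_4) (y0 h k C2 D2 C3 D3 : R -> R),
  [/\ [/\ M *m N = 1%:M, N *m M = 1%:M & row 0 M = gamma 0],
     [/\ smooth_at 0 h, h 0 = 0 & 0 < 'D_1 h 0],
     [/\ smooth_at 0 k, k 0 = 0,
         \forall u \near (0 : R), k (h u) = u & \forall t \near (0 : R), h (k t) = t],
     [/\ smooth_at 0 C2, smooth_at 0 D2, smooth_at 0 C3, smooth_at 0 D3 &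
         C2 0 != 0] &
     \forall u \near (0 : R), 0 < y0 u /\
       gamma u = y0 u *: (nrow 1 (h u ^+ 2)
         (h u ^+ 3 * (C2 (h u ^+ 2) + h u * D2 (h u ^+ 2)))
         (h u ^+ 2 * (C3 (h u ^+ 2) + h u * D3 (h u ^+ 2))) *m M)].
Proof.
move=> /cusp_coordinates[M [N [y0 [m1 [m2 [m3]]]]]].
case=> MN NM M0 [sy0 sm1 sm2 sm3] [y00 m10 m20 gE].
have sid : smooth_at (0 : R) id by exact: smooth_at_id.
(* After division by [y0], the first affine coordinate is u^2 [q u]; it becomes t^2 for t = h(u) = u
   sqrt(q u). *)
pose q u := m1 u * (y0 u)^-1.
have sq : smooth_at 0 q.
  by apply: smooth_atM => //; apply: smooth_atV => //; rewrite y00 oner_eq0.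
have q0 : q 0 = 2^-1 by rewrite /q m10 y00 invr1 mulr1.
pose r u := Num.sqrt (q u).
have q0gt : 0 < q 0 by rewrite q0 invr_gt0.
have sr : smooth_at 0 r by exact: smooth_at_sqrt.
have r0 : 0 < r 0 by rewrite sqrtr_gt0.
pose h u := u * r u.
have sh : smooth_at 0 h by exact: smooth_atM.
have h0 : h 0 = 0 by rewrite /h mul0r.
have dh : 'D_1 h 0 = r 0.
  have E := derM (is_derive_id (0 : R) (1 : R)) (smooth_at_derivable (1 : R) sr).
  by rewrite (is_deriveE E) mul1r mul0r addr0.
have [k [sk k0 kh hk]] : exists k : R -> R, [/\ smooth_at 0 k, k 0 = 0,
    \forall x \near (0 : R), k (h x) = x & \forall y \near (0 : R), h (k y) = y].
  by apply: smooth_inverse => //; rewrite dh.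
(* The other affine coordinates are h^3 [n2] and h^2 [n3]. Whitney's theorem applies to [n2] and
   [n3] in the parameter t, that is, composed with the inverse [k] of [h]. *)
pose n2 u := m2 u * (y0 u * r u ^+ 3)^-1.
pose n3 u := m3 u * (m1 u)^-1.
have sn2 : smooth_at 0 n2.
  apply: smooth_atM => //; apply: smooth_atV.
    by rewrite y00 mul1r expf_neq0// gt_eqF.
  by apply: smooth_atM => //; exact: smooth_atX.
have sn3 : smooth_at 0 n3.
  by apply: smooth_atM => //; apply: smooth_atV => //; rewrite m10 invr_eq0.
have [C2 [D2 [sC2 sD2 C20 E2]]] : exists C D : R -> R,
  [/\ smooth_at 0 C, smooth_at 0 D, C 0 = n2 (k 0) &
    \forall t \near (0 : R), n2 (k t) = C (t ^+ 2) + t * D (t ^+ 2)].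
  by apply: whitney; apply: smooth_at_comp => //; rewrite k0.
have [C3 [D3 [sC3 sD3 _ E3]]] : exists C D : R -> R,
  [/\ smooth_at 0 C, smooth_at 0 D, C 0 = n3 (k 0) &
    \forall t \near (0 : R), n3 (k t) = C (t ^+ 2) + t * D (t ^+ 2)].
  by apply: whitney; apply: smooth_at_comp => //; rewrite k0.
exists M, N, y0, h, k, C2, D2, C3, D3; split=> //.
- by split=> //; rewrite dh.
- split=> //; rewrite C20 k0 /n2 m20 y00 mul1r mulf_neq0// invr_eq0 ?expf_neq0//.
  by rewrite gt_eqF.
have ch : h u @[u --> (0 : R)] --> (0 : R).
  by have := smooth_at_continuous sh; rewrite /prop_for /continuous_at h0.
have n1 : \forall u \near (0 : R), 0 < y0 u.
  by apply: (cvgr_gt _ (smooth_at_continuous sy0)); rewrite y00.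
have n4 : \forall u \near (0 : R), 0 < q u.
  exact: (cvgr_gt _ (smooth_at_continuous sq)).
have n5 : \forall u \near (0 : R), 0 < m1 u.
  by apply: (cvgr_gt _ (smooth_at_continuous sm1)); rewrite m10 invr_gt0.
have n6 : \forall u \near (0 : R), n2 (k (h u)) = C2 (h u ^+ 2) + h u * D2 (h u ^+ 2).
  exact: (ch _ E2).
have n7 : \forall u \near (0 : R), n3 (k (h u)) = C3 (h u ^+ 2) + h u * D3 (h u ^+ 2).
  exact: (ch _ E3).
near=> u.
have yu : 0 < y0 u by near: u.
have qu : 0 < q u by near: u.
have mu : 0 < m1 u by near: u.
have e2 : n2 (k (h u)) = C2 (h u ^+ 2) + h u * D2 (h u ^+ 2) by near: u.
have e3 : n3 (k (h u)) = C3 (h u ^+ 2) + h u * D3 (h u ^+ 2) by near: u.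
have ku : k (h u) = u by near: u.
split=> //; rewrite gE scalemxAl -e2 -e3 ku; congr (_ *m M).
have rr : r u ^+ 2 = q u by rewrite sqr_sqrtr// ltW.
have ru : r u != 0 by rewrite gt_eqF// sqrtr_gt0.
have y0n : y0 u != 0 by rewrite gt_eqF.
have m1n : m1 u != 0 by rewrite gt_eqF.
apply: cr_inj; rewrite crZ !cr_nrow//=.
- by rewrite mulr1.
- by rewrite /h exprMn rr /q; field.
- by rewrite /h /n2; field; apply/andP.
- by rewrite /h /n3 exprMn rr /q; field; apply/andP.
Unshelve. all: by end_near. Qed.

End Cusp.

(** * The swallowtail *)

Lemma smooth_at_pair {R : realType} {V : normedModType R} (p : V) (f g : V -> R) :
  smooth_at p f -> smooth_at p g -> smooth_at p (fun q => (f q, g q)).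
Proof.
move=> sf sg; apply: (@smooth_at_ext _ _ _ _
  (fun q => f q *: (1, 0) + g q *: ((0, 1) : R * R))).
  near=> q; congr pair; rewrite /= /GRing.scale /=; ring.
by apply: smooth_atD; exact: smooth_atZl.
Unshelve. all: by end_near. Qed.

Lemma det_g_mulmx {R : realType} (M : 'M[R]_4) x y z w :
  det_g (x *m M) (y *m M) (z *m M) (w *m M) = det_g x y z w * \det M.
Proof.
rewrite /det_g -det_mulmx; congr (\det _); apply/row_matrixP => i.
by rewrite row_mul !rowK; case: i => [[|[|[|[|]]]]].
Qed.

(** * The diffeomorphism taking the standard swallowtail to the cusp *)

Section Chart.
Context {R : realType} (a : R) (M N : 'M[R]_4) (C2 D2 C3 D3 : R -> R) (kap : R).
Hypotheses (MN : M *m N = 1%:M) (NM : N *m M = 1%:M).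
Hypothesis M0 : space_form a (row 0 M).
Hypotheses (sC2 : smooth_at 0 C2) (sD2 : smooth_at 0 D2).
Hypotheses (sC3 : smooth_at 0 C3) (sD3 : smooth_at 0 D3).
Hypotheses (C20 : C2 0 != 0) (kap0 : kap != 0).

(** The triangular map Psi in affine coordinates. At (t^2, t^3, 0) it gives the normal form of the
    cusp. *)
Definition chart_row (s w r : R) := nrow 1 s
  (w * C2 s + s ^+ 2 * D2 s) (s * C3 s + w * D3 s + kap * r).

Definition chart (y : 'rV[R]_3) : 'rV[R]_4 := unitize a
  (chart_row (- y 0 (inord 0) / 6) (- y 0 (inord 1) / 4)
     ((y 0 (inord 2) + y 0 (inord 0) ^+ 2 / 12) / 12) *m M).

(** [ys], [yw] and [yr] solve the triangular system for s, w, r in turn. As functions of quotients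
    of coordinates they are unchanged by the central projection. *)
Let ys x := cr (x *m N) 1 / cr (x *m N) 0.
Let yw x := (cr (x *m N) 2 / cr (x *m N) 0 - ys x ^+ 2 * D2 (ys x)) / C2 (ys x).
Let yr x := (cr (x *m N) 3 / cr (x *m N) 0 - ys x * C3 (ys x) - yw x * D3 (ys x)) / kap.

Definition cochart (x : 'rV[R]_4) : 'rV[R]_3 :=
  \row_(i < 3) [:: - (6 * ys x); - (4 * yw x); 12 * yr x - 3 * ys x ^+ 2]`_i.

Lemma cochartE x k : (k < 3)%N -> cochart x 0 (inord k) =
  [:: - (6 * ys x); - (4 * yw x); 12 * yr x - 3 * ys x ^+ 2]`_k.
Proof. by move=> k3; rewrite mxE inordK. Qed.

Lemma chart_row000 : chart_row 0 0 0 *m M = row 0 M.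
Proof.
rewrite rowE; congr (_ *m M); apply/rowP => i; rewrite [LHS]crE cr_nrow// mxE.
by case: i => [[|[|[|[|]]]]] //= _; rewrite !(mul0r, mulr0, expr0n, addr0).
Qed.

Lemma smooth_at_nrow {V : normedModType R} (p : V) (f0 f1 f2 f3 : V -> R) :
  smooth_at p f0 -> smooth_at p f1 -> smooth_at p f2 -> smooth_at p f3 ->
  smooth_at p (fun q => nrow (f0 q) (f1 q) (f2 q) (f3 q)).
Proof.
move=> s0 s1 s2 s3; apply: smooth_at_row => -[[|[|[|[|//]]]] i4];
by under eq_fun do rewrite /nrow mxE /=.
Qed.

Lemma smooth_at_chart_row {V : normedModType R} (p : V) (s w r : V -> R) :
  s p = 0 -> smooth_at p s -> smooth_at p w -> smooth_at p r ->
  smooth_at p (fun q => chart_row (s q) (w q) (r q)).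
Proof.
move=> s0 ss sw sr.
have comp (C : R -> R) : smooth_at 0 C -> smooth_at p (fun q => C (s q)).
  by move=> sC; apply: smooth_at_comp => //; rewrite s0.
apply: smooth_at_nrow => //; first exact: smooth_at_cst.
  by apply: smooth_atD; apply: smooth_atM => //; try exact: smooth_atX; exact: comp.
apply: smooth_atD; last by apply: smooth_atM => //; exact: smooth_at_cst.
by apply: smooth_atD; apply: smooth_atM => //; exact: comp.
Qed.

Let arg (y : 'rV[R]_3) :=
  chart_row (- y 0 (inord 0) / 6) (- y 0 (inord 1) / 4)
     ((y 0 (inord 2) + y 0 (inord 0) ^+ 2 / 12) / 12) *m M.

Let arg0 : arg 0 = row 0 M.
Proof.
by rewrite -chart_row000 /arg !mxE !oppr0 !mul0r expr0n /= mul0r addr0 mul0r.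
Qed.

Let smooth_arg : smooth_at 0 arg.
Proof.
have sy i : smooth_at 0 (fun y : 'rV[R]_3 => y 0 i).
  by apply: smooth_at_coord; exact: smooth_at_id.
have sz (f : 'rV[R]_3 -> R) (t : R) : smooth_at 0 f -> smooth_at 0 (fun y => f y / t).
  by move=> sf; apply: smooth_atM => //; exact: smooth_at_cst.
apply/smooth_at_mulmx/smooth_at_chart_row.
- by rewrite mxE oppr0 mul0r.
- by apply: (sz _ _); exact: smooth_atN.
- by apply: (sz _ _); exact: smooth_atN.
- by apply: (sz _ _); apply: smooth_atD => //; apply: (sz _ _); exact: smooth_atX.
Qed.

Let arg_form0 : 0 < cform a (arg 0) (arg 0).
Proof. by rewrite arg0; case: M0 => ->. Qed.

Lemma smooth_at_chart : smooth_at 0 chart.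
Proof. exact: (smooth_at_unitize smooth_arg arg_form0). Qed.

Lemma chart0 : chart 0 = row 0 M.
Proof.
rewrite /chart -/(arg 0) arg0; have [M1 _] := M0.
by rewrite -[X in unitize a X]scale1r unitizeZ.
Qed.

Let cr_row0 : cr (row 0 M *m N) 0 = 1.
Proof. by rewrite -row_mul MN cr_row1. Qed.

Let smooth_cr k : smooth_at (row 0 M) (fun x : 'rV[R]_4 => cr (x *m N) k).
Proof. by apply: smooth_at_cr; apply: smooth_at_mulmx; exact: smooth_at_id. Qed.

Let ys0 : ys (row 0 M) = 0.
Proof. by rewrite /ys -row_mul MN !cr_row1// mul0r. Qed.

Let smooth_quot k :
  smooth_at (row 0 M) (fun x : 'rV[R]_4 => cr (x *m N) k / cr (x *m N) 0).
Proof.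
apply: smooth_atM => //; apply: smooth_atV => //.
by rewrite cr_row0 oner_eq0.
Qed.

Let smooth_comp_ys (C : R -> R) : smooth_at 0 C ->
  smooth_at (row 0 M) (fun x : 'rV[R]_4 => C (ys x)).
Proof.
move=> sC; suff sC0 : smooth_at (ys (row 0 M)) C.
  by apply: (smooth_at_comp sC0); exact: smooth_quot.
by rewrite ys0.
Qed.

Lemma smooth_at_cochart : smooth_at (row 0 M) cochart.
Proof.
have sys : smooth_at (row 0 M) ys by exact: smooth_quot.
have syw : smooth_at (row 0 M) yw.
  apply: smooth_atM; last by apply: smooth_atV; rewrite ?ys0//; exact: smooth_comp_ys.
  apply: smooth_atB => //; apply: smooth_atM; first exact: smooth_atX.
  exact: smooth_comp_ys.
have syr : smooth_at (row 0 M) yr.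
  apply: smooth_atM; last exact: smooth_at_cst.
  apply: smooth_atB; first apply: smooth_atB => //; apply: smooth_atM => //.
    exact: smooth_comp_ys.
  exact: smooth_comp_ys.
have st (t : R) f : smooth_at (row 0 M) f -> smooth_at (row 0 M) (fun x => t * f x).
  by move=> sf; apply: smooth_atM => //; exact: smooth_at_cst.
apply: smooth_at_row => -[[|[|[|//]]] i3]; under eq_fun do rewrite mxE /=.
- by apply/smooth_atN/st.
- by apply/smooth_atN/st.
- by apply: smooth_atB; apply: (st _ _) => //; exact: smooth_atX.
Qed.

(** Solving the system recovers x divided by its positive zeroth coordinate in the basis [M];
    [unitize] undoes the division on the space form. *)
Lemma chartK : \forall x \near row 0 M, space_form a x -> chart (cochart x) = x.
Proof.
have n1 : \forall x \near row 0 M, 0 < cr (x *m N) 0.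
  by apply: (cvgr_gt _ (smooth_at_continuous (smooth_cr 0))); rewrite cr_row0.
have n2 : \forall x \near row 0 M, C2 (ys x) != 0.
  apply: (cvgr_neq0 _ (smooth_at_continuous (smooth_comp_ys sC2))).
  by rewrite ys0.
near=> x; have x0 : 0 < cr (x *m N) 0 by near: x.
have xC : C2 (ys x) != 0 by near: x.
move=> [xx _]; rewrite /chart !cochartE//=.
rewrite [X in X *m M](_ : _ = (cr (x *m N) 0)^-1 *: (x *m N)).
  by rewrite -scalemxAl -mulmxA NM mulmx1 unitizeZ// invr_gt0.
have xn0 : cr (x *m N) 0 != 0 by rewrite gt_eqF.
have -> : - - (6 * ys x) / 6 = ys x by field.
have -> : - - (4 * yw x) / 4 = yw x by field.
have -> : (12 * yr x - 3 * ys x ^+ 2 + (- (6 * ys x)) ^+ 2 / 12) / 12 = yr x.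
  by field.
have ywE : yw x * C2 (ys x) =
    cr (x *m N) 2 / cr (x *m N) 0 - ys x ^+ 2 * D2 (ys x) by exact: divfK.
have yrE : kap * yr x = cr (x *m N) 3 / cr (x *m N) 0 - ys x * C3 (ys x) -
    yw x * D3 (ys x) by rewrite mulrC; exact: divfK.
rewrite /chart_row ywE yrE; apply: cr_inj; rewrite cr_nrow// crZ /=.
- by rewrite mulVf.
- by rewrite /ys mulrC.
- by rewrite subrK mulrC.
- by rewrite mulrC; ring.
Unshelve. all: by end_near. Qed.

Lemma cochartK : \forall y \near (0 : 'rV[R]_3),
  space_form a (chart y) /\ cochart (chart y) = y.
Proof.
have n1 : \forall y \near (0 : 'rV[R]_3), 0 < cform a (arg y) (arg y).
  exact: (cvgr_gt _ (smooth_at_continuous (smooth_at_cform a smooth_arg smooth_arg))).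
have n2 : \forall y \near (0 : 'rV[R]_3), a <= 0 -> 0 < cr (arg y) 0.
  have [_] := M0; rewrite -arg0; case: (a <= 0) => [/(_ isT)|_]; last by near=> p.
  rewrite (crE (arg 0) 0) => c0.
  by apply: filterS (cvgr_gt _ (smooth_at_continuous (smooth_at_cr 0 smooth_arg)) _ c0).
have n3 : \forall y \near (0 : 'rV[R]_3), C2 (- (y : 'rV[R]_3) 0 (inord 0) / 6) != 0.
  have ss : smooth_at (0 : 'rV[R]_3) (fun y : 'rV[R]_3 => C2 (- y 0 (inord 0) / 6)).
    apply: smooth_at_comp; first by rewrite mxE oppr0 mul0r.
    apply: smooth_atM; last exact: smooth_at_cst.
    by apply: smooth_atN; apply: smooth_at_coord; exact: smooth_at_id.
  apply: (cvgr_neq0 _ (smooth_at_continuous ss)).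
  by rewrite mxE oppr0 mul0r.
near=> y.
have yy : 0 < cform a (arg y) (arg y) by near: y.
split; first by apply: unitize_space_form => //; near: y.
have : C2 (- y 0 (inord 0) / 6) != 0 by near: y.
set s := - y 0 (inord 0) / 6 => Cs.
pose w := - y 0 (inord 1) / 4.
pose r := (y 0 (inord 2) + y 0 (inord 0) ^+ 2 / 12) / 12.
have [t t0 E] : exists2 t, t != 0 & chart y *m N = t *: chart_row s w r.
  exists (Num.sqrt (cform a (arg y) (arg y)))^-1.
    by rewrite invr_eq0 gt_eqF// sqrtr_gt0.
  by rewrite /chart /unitize -scalemxAl -mulmxA MN mulmx1.
have ysE : ys (chart y) = s by rewrite /ys E !crZ !cr_nrow//=; field.
have ywE : yw (chart y) = w.
  by rewrite /yw ysE E !crZ !cr_nrow//=; field; apply/andP.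
have yrE : yr (chart y) = r.
  by rewrite /yr ysE ywE E !crZ !cr_nrow//=; field; apply/andP.
apply/rowP => i; rewrite -(inord_val i) cochartE// ysE ywE yrE.
case: i => [[|[|[|//]]] i3] /=; rewrite /s /w /r; field.
Unshelve. all: by end_near. Qed.

Lemma diffeo_cochart : diffeo_germ (space_form a) setT (row 0 M) 0 cochart.
Proof.
split; [|exact: smooth_at_cochart|].
  by have [_] := nbhs_singleton cochartK; rewrite chart0.
exists chart; split; first exact: smooth_at_chart.
- by apply: filterS chartK => x H /H.
- by apply: filterS cochartK => y H _.
Qed.

End Chart.

Lemma is_derive_nrow {R : realType} {V : normedModType R} (p v : V)
    (f0 f1 f2 f3 : V -> R) d0 d1 d2 d3 :
  is_derive p v f0 d0 -> is_derive p v f1 d1 -> is_derive p v f2 d2 ->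
  is_derive p v f3 d3 ->
  is_derive p v (fun q => nrow (f0 q) (f1 q) (f2 q) (f3 q)) (nrow d0 d1 d2 d3).
Proof.
move=> H0 H1 H2 H3; apply/is_derive_row => i; rewrite /nrow mxE.
under eq_fun do rewrite mxE.
by case: i => [[|[|[|[|//]]]] i4].
Qed.

(** * The swallowtail along a cusp in normal form *)

Section Swallowtail.
Context {R : realType} (a : R) (M N : 'M[R]_4) (h k C2 D2 C3 D3 : R -> R).
Hypotheses (MN : M *m N = 1%:M) (NM : N *m M = 1%:M).
Hypothesis M0 : space_form a (row 0 M).
Hypotheses (sh : smooth_at 0 h) (h0 : h 0 = 0) (dh0 : 0 < 'D_1 h 0).
Hypotheses (sk : smooth_at 0 k) (k0 : k 0 = 0).
Hypotheses (kh : \forall u \near (0 : R), k (h u) = u).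
Hypotheses (hk : \forall t \near (0 : R), h (k t) = t).
Hypotheses (sC2 : smooth_at 0 C2) (sD2 : smooth_at 0 D2).
Hypotheses (sC3 : smooth_at 0 C3) (sD3 : smooth_at 0 D3).
Hypothesis C20 : C2 0 != 0.
Variable kap : R.
Hypothesis kap0 : kap != 0.
Hypothesis kapE : C2 0 * (8 * 'D_1 C3 0 + 2 * kap) - 8 * (D3 0 * D2 0) != 0.

(** With t = h(u), the functions [s], [w] and v^2 are the coordinates s, w, r of the standard
    swallowtail at (12 v - 6 t^2, t). *)
Let s (p : R * R) := h p.1 ^+ 2 - 2 * p.2.
Let w (p : R * R) := h p.1 * (h p.1 ^+ 2 - 3 * p.2).
Let P (p : R * R) := chart_row C2 D2 C3 D3 kap (s p) (w p) (p.2 ^+ 2) *m M.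
(** The vector field d/du + h h' d/dv annihilates [s], and sends [w] to -3 v h' and v^2 to 2 v h h'.
    So it sends P to v times a smooth map, which is [X], and [c] is -h h'. *)
Let c (p : R * R) := - (h p.1 * 'D_1 h p.1).
Let X (p : R * R) := nrow 0 0 (- (3 * ('D_1 h p.1 * C2 (s p))))
  ('D_1 h p.1 * (2 * (kap * h p.1) - 3 * D3 (s p))) *m M.

Let s0 : s 0 = 0. Proof. by rewrite /s h0 expr0n /= mulr0 subr0. Qed.
Let w0 : w 0 = 0. Proof. by rewrite /w h0 mul0r. Qed.

Let smooth_fst_comp (g : R -> R) (p : R * R) :
  smooth_at p.1 g -> smooth_at p (fun q : R * R => g q.1).
Proof. by move=> sg; apply: (smooth_at_comp sg); exact: smooth_at_fst. Qed.

Let smooth_s p : smooth_at p.1 h -> smooth_at p s.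
Proof.
move=> sp; apply: smooth_atB; first by apply: smooth_atX; exact: smooth_fst_comp.
by apply: smooth_atM; [exact: smooth_at_cst | exact: smooth_at_snd].
Qed.

Let smooth_w p : smooth_at p.1 h -> smooth_at p w.
Proof.
move=> sp; apply: smooth_atM; first exact: smooth_fst_comp.
apply: smooth_atB; first by apply: smooth_atX; exact: smooth_fst_comp.
by apply: smooth_atM; [exact: smooth_at_cst | exact: smooth_at_snd].
Qed.

Let sP : smooth_at 0 P.
Proof.
apply/smooth_at_mulmx/smooth_at_chart_row => //; first exact: smooth_s.
  exact: smooth_w.
by apply: smooth_atX; exact: smooth_at_snd.
Qed.

Let sh' : smooth_at 0 (fun u => 'D_1 h u). Proof. exact: smooth_at_derive. Qed.

Let smooth_comp_s (C : R -> R) : smooth_at 0 C -> smooth_at 0 (fun p => C (s p)).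
Proof.
move=> sC; have sCs : smooth_at (s 0) C by rewrite s0.
exact: (smooth_at_comp sCs (smooth_s (sh : smooth_at (0 : R * R).1 h))).
Qed.

Let sX : smooth_at 0 X.
Proof.
have st (t : R) (f : R * R -> R) : smooth_at 0 f -> smooth_at 0 (fun p => t * f p).
  by move=> sf; apply: smooth_atM => //; exact: smooth_at_cst.
have sH : smooth_at 0 (fun p : R * R => 'D_1 h p.1).
  exact: (@smooth_fst_comp (fun u => 'D_1 h u) 0 sh').
apply/smooth_at_mulmx/smooth_at_nrow; try exact: smooth_at_cst.
  by apply/smooth_atN/st/smooth_atM => //; exact: smooth_comp_s.
apply: smooth_atM => //; apply: smooth_atB; last exact/st/smooth_comp_s.
by apply/st/st; exact: (@smooth_fst_comp h 0 sh).
Qed.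

Let sc : smooth_at 0 c.
Proof.
apply/smooth_atN/smooth_atM; first exact: (@smooth_fst_comp h 0 sh).
exact: (@smooth_fst_comp (fun u => 'D_1 h u) 0 sh').
Qed.

Let good (p : R * R) := [/\ smooth_at p.1 h, smooth_at (s p) C2, smooth_at (s p) D2,
  smooth_at (s p) C3 & smooth_at (s p) D3].

Let near_good : \forall p \near (0 : R * R), good p.
Proof.
have cs : s p @[p --> (0 : R * R)] --> (0 : R).
  by have := smooth_at_continuous (smooth_s (sh : smooth_at (0 : R * R).1 h));
    rewrite /prop_for /continuous_at s0.
have n0 : \forall p \near (0 : R * R), smooth_at p.1 h.
  exact: (smooth_at_continuous (smooth_at_fst (0 : R * R)) (smooth_at_near sh)).
have nC (C : R -> R) : smooth_at 0 C -> \forall p \near (0 : R * R), smooth_at (s p) C.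
  by move=> sC; exact: (cs _ (smooth_at_near sC)).
have n1 := nC _ sC2; have n2 := nC _ sD2; have n3 := nC _ sC3; have n4 := nC _ sD3.
by near=> p; split; near: p.
Unshelve. all: by end_near. Qed.

Let dH (p d : R * R) : smooth_at p.1 h ->
  is_derive p d (fun q : R * R => h q.1) (d.1 * 'D_1 h p.1).
Proof.
move=> sp; apply: (derComp _ (is_derive_fst p d)); last exact: smooth_at_derivable.
by apply: smooth_at_diff; exact: smooth_at_fst.
Qed.

Let ds p d : smooth_at p.1 h ->
  is_derive p d s (2 * (h p.1 * (d.1 * 'D_1 h p.1)) - 2 * d.2).
Proof.
move=> sp; have H := derB (derX 2 (dH d sp)) (derM (derC p d (2 : R)) (is_derive_snd p d)).
by apply: is_derive_eq H _; rewrite /=; ring.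
Qed.

Let dw p d : smooth_at p.1 h -> is_derive p d w
  (d.1 * 'D_1 h p.1 * (3 * h p.1 ^+ 2 - 3 * p.2) - 3 * (h p.1 * d.2)).
Proof.
move=> sp; have H := derM (dH d sp)
  (derB (derX 2 (dH d sp)) (derM (derC p d (3 : R)) (is_derive_snd p d))).
by apply: is_derive_eq H _; rewrite /=; ring.
Qed.

Let dC (C : R -> R) p d t : smooth_at p.1 h -> smooth_at (s p) C -> is_derive p d s t ->
  is_derive p d (fun q => C (s q)) (t * 'D_1 C (s p)).
Proof.
move=> sp sC Hs; apply: (derComp _ Hs); last exact: smooth_at_derivable.
by apply: smooth_at_diff; exact: smooth_s.
Qed.

Let dP p d (t r : R) : good p -> is_derive p d s t -> is_derive p d w r ->
  'D_d P p = nrow 0 t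
    (r * C2 (s p) + w p * (t * 'D_1 C2 (s p)) +
      (2 * s p * t * D2 (s p) + s p ^+ 2 * (t * 'D_1 D2 (s p))))
    (t * C3 (s p) + s p * (t * 'D_1 C3 (s p)) +
      (r * D3 (s p) + w p * (t * 'D_1 D3 (s p))) + kap * (2 * p.2 * d.2)) *m M.
Proof.
move=> [sp h2 h3 h4 h5] Hs Hw; apply/is_deriveE/is_derive_mulmx/is_derive_nrow.
- have H := derD (derM Hw (dC sp h2 Hs)) (derM (derX 2 Hs) (dC sp h3 Hs)).
  by apply: is_derive_eq H _; rewrite /=; ring.
- have H := derD (derD (derM Hs (dC sp h4 Hs)) (derM Hw (dC sp h5 Hs)))
    (derM (derC p d kap) (derX 2 (is_derive_snd p d))).
  by apply: is_derive_eq H _; rewrite /=; ring.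
Qed.

Let relP :
  \forall p \near (0 : R * R), 'D_e_u P p = c p *: 'D_e_v P p + p.2 *: X p.
Proof.
apply: filterS near_good => p gp; have [sp _ _ _ _] := gp.
rewrite (dP gp (ds e_u sp) (dw e_u sp)) (dP gp (ds e_v sp) (dw e_v sp)) /X.
rewrite !scalemxAl -mulmxDl; congr (_ *m M).
by apply: cr_inj; rewrite crD !crZ !cr_nrow// /c /=; ring.
Qed.

Let Pv p := nrow 0 (-2)
    (- (3 * h p.1) * C2 (s p) + w p * (-2 * 'D_1 C2 (s p)) +
      (2 * s p * -2 * D2 (s p) + s p ^+ 2 * (-2 * 'D_1 D2 (s p))))
    (-2 * C3 (s p) + s p * (-2 * 'D_1 C3 (s p)) +
      (- (3 * h p.1) * D3 (s p) + w p * (-2 * 'D_1 D3 (s p))) + kap * (2 * p.2 * 1)) *m M.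

Let PvE : \forall p \near (0 : R * R), Pv p = 'D_e_v P p.
Proof.
apply: filterS near_good => p gp; have [sp _ _ _ _] := gp.
rewrite (dP gp (ds e_v sp) (dw e_v sp)) /Pv; congr (_ *m M).
by apply: cr_inj; rewrite !cr_nrow//=; ring.
Qed.

Let Pvv0 : 'D_e_v (fun p => 'D_e_v P p) 0 =
  nrow 0 0 (8 * D2 0) (8 * 'D_1 C3 0 + 2 * kap) *m M.
Proof.
have g0 : good 0 := nbhs_singleton near_good.
have [sp h2 h3 h4 h5] := g0.
have Hs : is_derive (0 : R * R) e_v s (-2).
  by apply: is_derive_eq (ds e_v sp) _; rewrite /=; ring.
have Hw : is_derive (0 : R * R) e_v w 0.
  by apply: is_derive_eq (dw e_v sp) _; rewrite /= h0; ring.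
have HH : is_derive (0 : R * R) e_v (fun q : R * R => h q.1) 0.
  by apply: is_derive_eq (dH e_v sp) _; rewrite /= mul0r.
(* These derivatives enter multiplied by [s] or [w], which vanish at the origin, so their existence
   suffices. *)
have D (C : R -> R) : smooth_at (s 0) C -> exists t,
    is_derive (0 : R * R) e_v (fun q => -2 * 'D_1 C (s q)) t.
  move=> sC; have sC' : smooth_at (s 0) (fun u => 'D_1 C u) by exact: smooth_at_derive.
  by eexists; apply: (derM (derC _ _ (-2 : R)) (dC sp sC' Hs)).
have [t2 H2] := D _ h2; have [t3 H3] := D _ h3; have [t4 H4] := D _ h4.
have [t5 H5] := D _ h5.
rewrite -(near_eq_derive e_v PvE); apply/is_deriveE/is_derive_mulmx/is_derive_nrow.
- have H := derD (derD (derM (derN (derM (derC 0 e_v (3 : R)) HH)) (dC sp h2 Hs))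
      (derM Hw H2))
    (derD (derM (derM (derM (derC 0 e_v (2 : R)) Hs) (derC 0 e_v (-2 : R))) (dC sp h3 Hs))
      (derM (derX 2 Hs) H3)).
  by apply: is_derive_eq H _; rewrite /= s0 w0 h0; ring.
- have H := derD (derD (derD (derM (derC 0 e_v (-2 : R)) (dC sp h4 Hs)) (derM Hs H4))
    (derD (derM (derN (derM (derC 0 e_v (3 : R)) HH)) (dC sp h5 Hs)) (derM Hw H5)))
    (derM (derC 0 e_v kap) (derM (derM (derC 0 e_v (2 : R)) (is_derive_snd 0 e_v))
      (derC 0 e_v (1 : R)))).
  by apply: is_derive_eq H _; rewrite /= s0 w0 h0; ring.
Qed.

Let P0 : P 0 = row 0 M.
Proof. by rewrite /P s0 w0 expr0n /= chart_row000. Qed.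

(** In the basis [M], P is (1, 0, 0, 0) at the origin, X and P_vv have only their last two
    coordinates, and P_v has second coordinate -2. What remains is a 2 by 2 determinant, equal up to
    a nonzero factor to the expression in [kapE]. *)
Let nondeg :
  det_g (P 0) (X 0) ('D_e_v P 0) ('D_e_v (fun p => 'D_e_v P p) 0) != 0.
Proof.
rewrite Pvv0 -(nbhs_singleton PvE) /P /X /Pv s0 w0 h0 /= !det_g_mulmx.
apply: mulf_neq0; last first.
  have := congr1 determinant MN; rewrite det_mulmx det1 => E.
  by apply/eqP => M00; move: E; rewrite M00 mul0r => /esym/eqP; rewrite oner_eq0.
rewrite (_ : det_g _ _ _ _ = - (6 * 'D_1 h 0 *
    (C2 0 * (8 * 'D_1 C3 0 + 2 * kap) - 8 * (D3 0 * D2 0)))).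
  by rewrite oppr_eq0 mulf_neq0// mulf_neq0// ?pnatr_eq0// gt_eqF.
by rewrite det_gE /minor3 /det3 /= /chart_row !cr_nrow//=; ring.
Qed.

Lemma swallowtail_of_chart :
  generic_swallowtail a (fun p => unitize a (P p)).
Proof.
have c0 : c 0 = 0 by rewrite /c h0 mul0r oppr0.
have P0M : space_form a (P 0) by rewrite P0.
have [nf sf adm gen] := front_generic sP sX sc c0 P0M relP nondeg.
split=> //; split=> //.
(* [psi] is (u, v) to (12 v - 6 h(u)^2, h(u)), so that f = chart o std o psi; [phi] is its explicit
   inverse, since [k] inverts [h]. The target diffeomorphism is the inverse [cochart] of the
   chart. *)
pose phi (q : R * R) := (k q.2, (q.1 + 6 * q.2 ^+ 2) / 12).
pose psi (q : R * R) := (12 * q.2 - 6 * h q.1 ^+ 2, h q.1).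
have psi0 : psi 0 = 0 by rewrite /psi h0 expr0n /= !mulr0 subrr.
have fE p : unitize a (P p) =
    chart a M C2 D2 C3 D3 kap (std_swallowtail (psi p)).
  rewrite /chart /P /std_swallowtail /= !mxE !inordK//=.
  by congr (unitize a (chart_row _ _ _ _ _ _ _ _ *m M)); rewrite /s /w; field.
have npsi : \forall q \near (0 : R * R), psi (phi q) = q.
  have n : \forall q \near (0 : R * R), h (k q.2) = q.2 
    by exact: (smooth_at_continuous (smooth_at_snd (0 : R * R)) hk).
  apply: filterS n => q hq; rewrite /psi /phi /= hq.
  by case: q {hq} => u v /=; congr pair; field.
have nphi : \forall q \near (0 : R * R), phi (psi q) = q.
  have n : \forall q \near (0 : R * R), k (h q.1) = q.1 
    by exact: (smooth_at_continuous (smooth_at_fst (0 : R * R)) kh).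
  apply: filterS n => q kq; rewrite /psi /phi /= kq.
  by case: q {kq} => u v /=; congr pair; field.
have sstd : smooth_at (0 : R * R) (@std_swallowtail R).
  have su := smooth_at_fst (0 : R * R); have sv := smooth_at_snd (0 : R * R).
  have st (t : R) (f : R * R -> R) : smooth_at 0 f -> smooth_at 0 (fun p => t * f p).
    by move=> sf'; apply: smooth_atM => //; exact: smooth_at_cst.
  apply: smooth_at_row => i.
  have -> : (fun p => @std_swallowtail R p 0 i) = (fun p : R * R =>
      [:: p.1; 2 * p.2 ^+ 3 + p.1 * p.2; 3 * p.2 ^+ 4 + p.1 * p.2 ^+ 2]`_i).
    by apply/funext => -[u v]; rewrite /std_swallowtail mxE.
  case: i => [[|[|[|//]]] i3] //=; (apply: smooth_atD; [apply/st; exact: smooth_atX |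
    apply: smooth_atM => //; exact: smooth_atX]).
have std0 : @std_swallowtail R 0 = 0.
  apply/rowP => i; rewrite !mxE; case: i => [[|[|[|//]]] i3] //=;
  by rewrite !expr0n /= !mulr0 addr0.
have f0 : unitize a (P 0) = row 0 M by rewrite fE psi0 std0 chart0.
have sphi : smooth_at (0 : R * R) phi.
  apply: smooth_at_pair.
    exact: (smooth_at_comp (sk : smooth_at (0 : R * R).2 k) (smooth_at_snd _)).
  apply: smooth_atM; last exact: smooth_at_cst.
  apply: smooth_atD; first exact: smooth_at_fst.
  by apply: smooth_atM; [exact: smooth_at_cst | apply: smooth_atX; exact: smooth_at_snd].
have spsi : smooth_at (0 : R * R) psi.
  apply: smooth_at_pair; last exact: (@smooth_fst_comp h 0 sh).
  apply: smooth_atB; apply: smooth_atM; try exact: smooth_at_cst.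
    exact: smooth_at_snd.
  by apply: smooth_atX; exact: (@smooth_fst_comp h 0 sh).
exists phi, (cochart N C2 D2 C3 D3 kap); split.
- split=> //; first by rewrite /phi k0 /= expr0n /= mulr0 addr0 mul0r.
  exists psi; split=> //; first by apply: filterS npsi => q ->.
  by apply: filterS nphi => q ->.
- by rewrite f0; exact: diffeo_cochart.
have n : \forall p \near (0 : R * R), cochart N C2 D2 C3 D3 kap
    (chart a M C2 D2 C3 D3 kap (std_swallowtail p)) = std_swallowtail p.
  have cstd : @std_swallowtail R p @[p --> (0 : R * R)] --> (0 : 'rV[R]_3).
    by have := smooth_at_continuous sstd; rewrite /prop_for /continuous_at std0.
  have nc : \forall p \near (0 : R * R),
      space_form a (chart a M C2 D2 C3 D3 kap (std_swallowtail p)) /\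
      cochart N C2 D2 C3 D3 kap (chart a M C2 D2 C3 D3 kap (std_swallowtail p)) =
        std_swallowtail p.
    exact: (cstd _ (cochartK MN M0 sC2 sD2 sC3 sD3 C20 kap0)).
  by apply: filterS nc => p [].
by apply: filterS (filterI npsi n) => p [pp np]; rewrite fE pp.
Unshelve. all: by end_near. Qed.

End Swallowtail.

Theorem propositionB (R : realType) (a : R) (gamma : R -> 'rV[R]_4)
    (hgamma : space_cusp a gamma) :
  exists f : R * R -> 'rV[R]_4,
    generic_swallowtail a f /\ \forall u \near (0 : R), f (u, 0) = gamma u.
Proof.
have [_ gM _ _] := hgamma.
have [M [N [y0 [h [k [C2 [D2 [C3 [D3 H]]]]]]]]] := cusp_normal_form hgamma.
case: H => [[MN NM M0] [sh h0 dh0] [sk k0 kh hk] [sC2 sD2 sC3 sD3 C20] gE].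
have gM0 : space_form a (row 0 M) by rewrite M0; exact: nbhs_singleton gM.
(* The expression is affine in [kap] with slope 2 C2(0), which is nonzero, so it cannot vanish at
   both 1 and 2. *)
have [kap kap0 kapE] : exists2 kap : R, kap != 0 &
    C2 0 * (8 * 'D_1 C3 0 + 2 * kap) - 8 * (D3 0 * D2 0) != 0.
  have [E|E] := eqVneq (C2 0 * (8 * 'D_1 C3 0 + 2 * 1) - 8 * (D3 0 * D2 0)) 0.
    exists 2; rewrite ?pnatr_eq0//.
    rewrite (_ : _ - _ = C2 0 * (8 * 'D_1 C3 0 + 2 * 1) - 8 * (D3 0 * D2 0) + 2 * C2 0);
      last ring.
    by rewrite E add0r mulf_neq0// pnatr_eq0.
  by exists 1; rewrite ?oner_eq0.
eexists; split.
  exact: (swallowtail_of_chart MN NM gM0 sh h0 dh0 sk k0 kh hk sC2 sD2 sC3 sD3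
    C20 kap0 kapE).
apply: filterS (filterI gE gM) => u [[y0u gu] [gg _]] /=.
(* On v = 0 the map before projection is gamma(u) divided by y0(u) > 0, and the projection brings it
   back to gamma(u). *)
rewrite -[RHS](@unitizeZ _ a (y0 u)^-1) ?invr_gt0//.
rewrite [in RHS]gu scalerA mulVf ?gt_eqF// scale1r.
congr (unitize a (_ *m M)).
by rewrite !mulr0 !subr0 expr0n /= /chart_row; congr nrow; ring.
Qed.
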